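(* Let $\langle X, R\rangle$ be any Borel digraph. Exactly one of the following alternatives holds: (1) $\vec{\chi}^{w}_{B}(\langle X,R\rangle)\leq\aleph_0$; (2) for every selector $E$, there exists $f\in\mathcal{F}$ such that both of the following hold: (a) for all $n,m\in\omega$, if $E(f\restriction m)\subseteq E(f\restriction n)$, then $f(m)\leq f(n)$; (b) there is a continuous minimal homomorphism $\Pi$ from $\mathcal{G}_0(E,f)$ to $\langle X,R\rangle$.
   Context: Digraphs: a digraph is a pair $\langle X,R\rangle$ with $R\subseteq X\times X$ and $\langle x,x\rangle\notin R$ for all $x\in X$. It is Borel (analytic) if $X$ is a Polish space and $R$ is a Borel (analytic) subset of $X\times X$. For $Y\subseteq X$, an $R$-cycle in $Y$ is a finite non-empty sequence $\langle y_0,\dots,y_k\rangle$ of elements of $Y$ with $y_i R y_{i+1}$ for all $i<k$ and $y_k R y_0$. The cycle $\langle x_0,\dots,x_n\rangle$ is minimal if for all $i,j<n+1$: $\langle x_i,x_j\rangle\in R$ iff $j=i+1 \bmod (n+1)$. For an analytic digraph $\langle X,R\rangle$, the weak Borel dichromatic number $\vec{\chi}^{w}_{B}(\langle X,R\rangle)$ is the minimal cardinal $\kappa$ such that $X=\bigcup_{\alpha<\kappa}X_\alpha$ for some Borel sets $X_\alpha\subseteq X$ none of which contains an $R$-cycle. A minimal homomorphism from a digraph $\langle X,R\rangle$ to a digraph $\langle Y,S\rangle$ is a function $\Pi:X\to Y$ such that (i) $\langle x,y\rangle\in R$ implies $\langle\Pi(x),\Pi(y)\rangle\in S$; and (ii)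 for every minimal $R$-cycle $\langle z_0,\dots,z_m\rangle$ in $X$ and all $i,j<m+1$ with $\langle z_i,z_j\rangle\notin R$, $\langle\Pi(z_i),\Pi(z_j)\rangle\notin S$. Let $\mathcal{F}=\{f\in\omega^\omega:\forall k\, f(k)\geq 2\}$ and $\mathcal{F}_{<\omega}=\bigcup_{l<\omega}\{s\in\omega^l:\forall k<l\ s(k)\geq2\}$. For $\sigma\in\mathcal{F}_{<\omega}$ let $T_{[\sigma]}=\prod_{k\in\mathrm{dom}(\sigma)}\sigma(k)$. For $f\in\mathcal{F}$ let $T_f=\bigcup_{l\in\omega}\prod_{k<l}f(k)$ and $[T_f]=\prod_{k\in\omega}f(k)$, with the product topology. A selector is a function $E:\mathcal{F}_{<\omega}\to\omega^{<\omega}$ with $E(\sigma)\in T_{[\sigma]}$ for every $\sigma$. For a selector $E$ and $f\in\mathcal{F}$, $\mathcal{G}_0(E,f)=\langle[T_f],R_{E,f}\rangle$ is the Borel digraph where for $y,z\in[T_f]$, $\langle y,z\rangle\in R_{E,f}$ iff there exist $l\in\omega$ and $x\in\omega^\omega$ such that $z(l)=y(l)+1 \bmod f(l)$, $y=E(f\restriction l)^\frown\langle y(l)\rangle^\frown x$ and $z=E(f\restriction l)^\frown\langle z(l)\rangle^\frown x$. *)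

(* Defs.v *)
From HB Require Import structures.
From mathcomp Require Import all_boot all_order all_algebra.
From mathcomp Require Import all_classical all_reals topology measure.

Set Implicit Arguments.
Unset Strict Implicit.
Unset Printing Implicit Defensive.

Import Order.TTheory GRing.Theory Num.Theory.

Local Open Scope classical_set_scope.

Definition separable (T : topologicalType) : Prop :=
  exists2 D : set T, countable D & dense D.

Definition is_metric (K : realType) (T : Type) (d : T -> T -> K) : Prop :=
  [/\ forall x y, d x y = 0%R <-> x = y,
      forall x y, d x y = d y x
    & forall x y z, (d x z <= d x y + d y z)%R].

Definition metric_induces_topology (K : realType) (T : topologicalType)
    (d : T -> T -> K) : Prop :=
  forall (x : T) (A : set T),
    nbhs x A <-> exists2 e : K, (0 < e)%R & [set y | (d x y < e)%R] `<=` A.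

Definition complete_metric (K : realType) (T : topologicalType)
    (d : T -> T -> K) : Prop :=
  forall u : nat -> T,
    (forall e : K, (0 < e)%R ->
      exists N, forall m n, (N <= m)%N -> (N <= n)%N -> (d (u m) (u n) < e)%R) ->
    exists l : T, u @ \oo --> l.

(* All real types [K] are isomorphic, so the choice of [K] is immaterial. *)
Definition polish (K : realType) (T : topologicalType) : Prop :=
  separable T /\
  exists d : T -> T -> K,
    [/\ is_metric d, metric_induces_topology d & complete_metric d].

Definition borel (T : topologicalType) : set (set T) := <<s @open T >>.

Definition digraph (X : Type) (R : set (X * X)) : Prop :=
  forall x, ~ R (x, x).

Definition borel_digraph (K : realType) (X : topologicalType)
    (R : set (X * X)) : Prop :=
  [/\ polish K X, digraph R & borel R].

(* [ordS i] is [i + 1] modulo [n + 1]. *)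
Definition is_cycle (X : Type) (R : set (X * X)) (n : nat)
    (y : 'I_n.+1 -> X) : Prop :=
  forall i : 'I_n.+1, R (y i, y (ordS i)).

Definition is_minimal_cycle (X : Type) (R : set (X * X)) (n : nat)
    (x : 'I_n.+1 -> X) : Prop :=
  is_cycle R x /\ forall i j : 'I_n.+1, R (x i, x j) <-> j = ordS i.

Definition contains_cycle (X : Type) (R : set (X * X)) (Y : set X) : Prop :=
  exists (n : nat) (y : 'I_n.+1 -> X), (forall i, Y (y i)) /\ is_cycle R y.

Definition acyclic_borel_cover (X : topologicalType) (R : set (X * X))
    (I : Type) : Prop :=
  exists A : I -> set X,
    [/\ forall i, borel (A i),
        [set: X] = \bigcup_i A i
      & forall i, ~ contains_cycle R (A i)].

(* Cardinals are represented by types, compared by injections: [I] has the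
   least cardinality among the index types of such covers. *)
Definition is_weak_borel_dichromatic_number (X : topologicalType)
    (R : set (X * X)) (I : Type) : Prop :=
  acyclic_borel_cover R I /\
  forall J : Type, acyclic_borel_cover R J -> ([set: I] #<= [set: J])%card.

Definition weak_borel_dichromatic_number_le (X : topologicalType)
    (R : set (X * X)) (J : Type) : Prop :=
  exists2 I : Type, is_weak_borel_dichromatic_number R I
                  & ([set: I] #<= [set: J])%card.

Definition minimal_homomorphism (X Y : Type) (R : set (X * X))
    (S : set (Y * Y)) (Pi : X -> Y) : Prop :=
  (forall x y, R (x, y) -> S (Pi x, Pi y)) /\
  (forall (m : nat) (z : 'I_m.+1 -> X), is_minimal_cycle R z ->
     forall i j : 'I_m.+1, ~ R (z i, z j) -> ~ S (Pi (z i), Pi (z j))).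

Definition calF : set (nat -> nat) := [set f | forall k, (2 <= f k)%N].

Definition calF_fin : set (seq nat) := [set s | all (leq 2) s].

(* [all2] also requires both sequences to have the same length. *)
Definition finite_product (sigma : seq nat) : set (seq nat) :=
  [set t | all2 ltn t sigma].

(* Values of a selector outside [calF_fin] are irrelevant: it is only ever
   applied to restrictions of elements of [calF]. *)
Definition selector (E : seq nat -> seq nat) : Prop :=
  forall sigma, calF_fin sigma -> finite_product sigma (E sigma).

Definition restr (f : nat -> nat) (l : nat) : seq nat := mkseq f l.

Definition branches (f : nat -> nat) : topologicalType :=
  prod_topology (fun k : nat => discrete_topology 'I_(f k)).

Definition branch_val (f : nat -> nat) (y : branches f) : nat -> nat :=
  fun k => nat_of_ord (y k : 'I_(f k)).

Definition scat (s : seq nat) (x : nat -> nat) : nat -> nat :=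
  fun n => if (n < size s)%N then nth 0%N s n else x (n - size s)%N.

Definition G0 (E : seq nat -> seq nat) (f : nat -> nat) :
    set (branches f * branches f) :=
  [set yz | let y := branch_val yz.1 in let z := branch_val yz.2 in
    exists (l : nat) (x : nat -> nat),
      [/\ z l = (y l + 1) %% f l,
          y = scat (E (restr f l) ++ [:: y l]) x
        & z = scat (E (restr f l) ++ [:: z l]) x]].

Arguments G0 : clear implicits.

Definition exactly_one (P Q : Prop) : Prop := (P \/ Q) /\ ~ (P /\ Q).

(* Main.v *)
Require Import Defs.
From mathcomp Require Import all_boot all_order all_algebra.
From mathcomp Require Import all_classical all_reals topology measure.

Set Implicit Arguments.
Unset Strict Implicit.
Unset Printing Implicit Defensive.

Import Order.TTheory GRing.Theory Num.Theory.

Local Open Scope classical_set_scope.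

(** The alternatives exclude each other by Baire category.  There is a selector
    [E] such that the vertices [E(f|l)] are dense in every tree [T_f].  Then every
    nonmeager set with the Baire property in [[T_f]] contains a whole basic cycle
    [E(f|l)^a^x], [a < f(l)], of [G_0(E,f)], and a countable cover of [X] by
    Borel sets, pulled back along a continuous homomorphism, has a piece that
    contains a cycle ([no_borel_cover]).

    Suppose now that [X] is not a countable union of acyclic Borel sets, and call
    such unions sigma-acyclic.  The function [f] and the homomorphism are found by
    approximation.  At stage [n] there is a set [H_n] of maps from the vertices of
    length [n] to [X], which is analytic and large: no sigma-acyclic set meets the
    ranges of all its members.  The main point ([large_amalgam_cycles]) is that for
    some [p] the amalgams of [p] members of [H_n], whose values at the vertex
    [E(f|n)] form a cycle, are again a large set.  Otherwise one sigma-acyclic set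
    [U] meets all these amalgams; the members of [H_n] that avoid [U] have values
    without cycles at [E(f|n)], and, as an analytic acyclic set is contained in a
    Borel acyclic one ([acyclic_reflection]), these remaining members are also
    taken care of by one acyclic Borel set.  The least such [p] is taken as [f(n)].
    Then the cycles are minimal, since a chord gives a shorter cycle, and
    [f(m) <= f(n)] when [E(f|n)] extends [E(f|m)], since a cycle made at stage [n]
    restricts to one at stage [m].

    To pass to the limit, analytic sets are handled through codes in the Baire
    space such that convergence of the codes implies convergence of the coded maps
    inside the set.  At each stage so many digits of the codes are fixed that,
    along every branch, the codes of the restrictions to any given stage converge.
    The limit map then restricts, at every stage, to members of [H_n]
    ([limit_map_cycle]), so each basic cycle is sent to a minimal cycle.  Non-edges
    are respected as well, because every cycle without repetitions in [G_0(E,f)]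
    stays within a basic cycle ([injective_cycle_block]). *)
(** * Polish spaces through closed countable covers *)

(** What the arguments below use of a Polish metric: [B k] is a cover by closed
    balls of radius about [1 / k], numbered by centres from a countable dense
    set, so that a sequence which is eventually in one ball of each radius
    converges, and balls of one radius shrink to each point uniformly in their
    centre. *)
Definition sieve (X : topologicalType) (B : nat -> nat -> set X) : Prop :=
  [/\ forall k i, closed (B k i),
      forall k x, exists i, B k i x,
      forall (u : nat -> X) (c : nat -> nat),
        (forall k, \forall m \near \oo, B k (c k) (u m)) ->
        exists x : X, u @ \oo --> x
    & forall (x : X) (U : set X), nbhs x U ->
        exists k, forall i, B k i x -> B k i `<=` U].

Section Metric.
Variables (K : realType) (X : topologicalType) (d : X -> X -> K).
Hypotheses (md : is_metric d) (td : metric_induces_topology d).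

Let dC x y : d x y = d y x. Proof. by case: md. Qed.
Let dT x y z : (d x z <= d x y + d y z)%R. Proof. by case: md. Qed.
Let d0 x : d x x = 0%R. Proof. by case: md => /(_ x x)[_ ->]. Qed.
Let d_ge0 x y : (0 <= d x y)%R.
Proof.
have := dT x y x; rewrite d0 [d y x]dC -mulr2n.
by rewrite pmulrn_lge0.
Qed.

Lemma nbhs_metric_ball x (e : K) : (0 < e)%R -> nbhs x [set y | (d x y < e)%R].
Proof. by move=> e0; apply/td; exists e. Qed.

Lemma metric_hausdorff : hausdorff_space X.
Proof.
move=> x y xy; have [//|dxy] := pselect (x = y).
have e0 : (0 < d x y / 2)%R.
  rewrite divr_gt0 // lt_neqAle d_ge0 andbT eq_sym; apply/eqP => h.
  by apply: dxy; case: md => /(_ x y)[/(_ h)].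
have [z [/= xz yz]] := xy _ _ (nbhs_metric_ball x e0) (nbhs_metric_ball y e0).
have := dT x z y; rewrite leNgt (dC z y).
by rewrite [X in (_ < X)%R](splitr (d x y)) ltrD.
Qed.

Lemma closed_metric_ball q (e : K) : closed [set x | (d q x <= e)%R].
Proof.
move=> x cx /=; rewrite leNgt; apply/negP => lt.
have e0 : (0 < d q x - e)%R by rewrite subr_gt0.
have [y [/= qy xy]] := cx _ (nbhs_metric_ball x e0).
have := dT q y x; rewrite leNgt (dC y x) => /negP; apply.
by rewrite -[X in (_ < X)%R](subrK e) addrC ltr_leD.
Qed.

Lemma small_radius (e : K) : (0 < e)%R -> exists k : nat, (k.+1%:R^-1 < e)%R.
Proof.
by move=> /ltr_add_invr[k]; rewrite add0r; exists k.
Qed.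

Lemma metric_sieve : separable X -> complete_metric d ->
  exists B : nat -> nat -> set X, sieve B.
Proof.
move=> [D cD dD] cd.
have [f finj] : exists f : X -> nat, {in D &, injective f}.
  by move/countable_injP: cD.
pose B k i := [set x | exists2 q, D q /\ f q = i & (d q x <= k.+1%:R^-1)%R].
have Bball k i : B k i = set0 \/
    exists q, B k i = [set x | (d q x <= k.+1%:R^-1)%R].
  have [[q [Dq fq]]|no] := pselect (exists q, D q /\ f q = i).
    right; exists q; apply/seteqP; split => [x [q' [Dq' fq'] h]|x h].
      by rewrite /= (_ : q = q') //; apply: finj; rewrite ?inE // fq.
    by exists q.
  left; apply/seteqP; split => // x [q ? _]; case: no; by exists q.
have Bdiam k i x y : B k i x -> B k i y -> (d x y <= k.+1%:R^-1 + k.+1%:R^-1)%R.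
  case: (Bball k i) => [->//|[q ->]] /= h1 h2.
  by apply: le_trans (dT x q y) _; rewrite dC lerD.
have kpos k : (0 < k.+1%:R^-1 :> K)%R by rewrite invr_gt0 ltr0Sn.
have half (e : K) : (0 < e)%R -> exists k : nat, (k.+1%:R^-1 + k.+1%:R^-1 < e)%R.
  move=> e0; have [|k hk] := @small_radius (e / 2)%R; first by rewrite divr_gt0.
  by exists k; rewrite (splitr e) ltrD.
exists B; split.
- move=> k i; case: (Bball k i) => [->|[q ->]]; first exact: closed0.
  exact: closed_metric_ball.
- move=> k x.
  have /dD : [set y | (d x y < k.+1%:R^-1)%R]° !=set0.
    by exists x; apply: nbhs_metric_ball.
  move=> /(_ (@open_interior _ _))[q [/interior_subset /= xq Dq]].
  by exists (f q), q => //; rewrite dC ltW.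
- move=> u c uc; apply: cd => e e0.
  have [k hk] := half e e0.
  have [N _ hN] := uc k.
  exists N => m n mN nN; apply: le_lt_trans hk.
  by apply: Bdiam (hN _ mN) (hN _ nN).
- move=> x U /td[e e0 eU].
  have [k hk] := half e e0.
  exists k => i Bx y By; apply: eU => /=; apply: le_lt_trans hk.
  exact: Bdiam Bx By.
Qed.
End Metric.

Lemma polish_sieve (K : realType) (X : topologicalType) : polish K X ->
  hausdorff_space X /\ exists B : nat -> nat -> set X, sieve B.
Proof.
move=> [sX [d [md td cd]]]; split; first exact: metric_hausdorff md td.
exact: metric_sieve md td sX cd.
Qed.

(** * Analytic sets of maps *)

(** All sets of points, of pairs and of approximations to a homomorphism are
    sets of maps [V -> X] with [V] countable, under pointwise convergence. *)

(** Codes are points of the Baire space; one code carries countably many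
    subcodes, which can be prescribed independently ([subcode_join]). *)
Definition subcode (c : nat -> nat) (i : nat) : nat -> nat :=
  fun k => c (pickle (i, k)).

Definition join_codes (cs : nat -> nat -> nat) : nat -> nat :=
  fun j => if unpickle j is Some (i, k) then cs i k else 0%N.

Lemma subcode_join cs i : subcode (join_codes cs) i = cs i.
Proof. by apply/funext => k; rewrite /subcode /join_codes pickleK. Qed.

Definition code_cvg (cs : nat -> nat -> nat) (c : nat -> nat) : Prop :=
  forall k, \forall m \near \oo, cs m k = c k.

Lemma subcode_cvg cs c i :
  code_cvg cs c -> code_cvg (fun m => subcode (cs m) i) (subcode c i).
Proof. by move=> h k; apply: h. Qed.

Definition pointwise_cvg (X : topologicalType) (V : Type)
    (hs : nat -> V -> X) (h : V -> X) : Prop :=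
  forall v, (fun m => hs m v) @ \oo --> h v.

(** A sequence of maps converges as soon as some sequence of its codes does,
    and the limit of the codes is then a code of the limit.  No choice of codes
    is made: along a given sequence of codes only the maps matter, so the
    property survives projections and countable operations. *)
Definition coded (X : topologicalType) (V : Type)
    (F : (V -> X) -> (nat -> nat) -> Prop) : Prop :=
  forall hs cs c, (\forall m \near \oo, F (hs m) (cs m)) -> code_cvg cs c ->
    exists2 h, F h c & pointwise_cvg hs h.

(** In a Polish space these are the usual analytic sets: a projection of a closed
    set [C] of pairs is coded by the relation that [c] codes a point [z], balls
    around [z], and a witness for [z] in [C]. *)
Definition analytic (X : topologicalType) (V : Type) (A : set (V -> X)) : Prop :=
  exists2 F, coded F & A = [set h | exists c, F h c].

Section Analytic.
Variables (X : topologicalType) (B : nat -> nat -> set X).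
Hypotheses (hX : hausdorff_space X) (sB : sieve B).

Lemma seq_cvg_unique (u : nat -> X) (x y : X) :
  u @ \oo --> x -> u @ \oo --> y -> x = y.
Proof.
move=> ux uy; apply: hX => U W /ux xU /uy yW.
by have [z ?] := filter_ex (filterI xU yW); exists z.
Qed.

Lemma closed_seq_cvg (T : topologicalType) (A : set T) (u : nat -> T) (x : T) :
  closed A -> (\forall m \near \oo, A (u m)) -> u @ \oo --> x -> A x.
Proof.
move=> cA Au ux; apply: cA => W /ux xW.
by have [m [? ?]] := filter_ex (filterI Au xW); exists (u m).
Qed.

Lemma pointwise_cvg_unique (V : Type) (hs : nat -> V -> X) h h' :
  pointwise_cvg hs h -> pointwise_cvg hs h' -> h = h'.
Proof.
by move=> c c'; apply/funext => v; apply: seq_cvg_unique (c v) (c' v).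
Qed.

Definition total_code (V : countType) (h : V -> X) (c : nat -> nat) : Prop :=
  forall v k, B k (subcode c (pickle v) k) (h v).

(** Along converging codes each coordinate is eventually in one ball of each
    radius, hence converges. *)
Lemma coded_total (V : countType) : coded (@total_code V).
Proof.
move=> hs cs c Fs csc; case: sB => cl _ cpl _.
have ev v k : \forall m \near \oo, B k (subcode c (pickle v) k) (hs m v).
  near=> m.
  have <- : subcode (cs m) (pickle v) k = subcode c (pickle v) k.
    by near: m; apply: subcode_cvg csc k.
  have : total_code (hs m) (cs m) by near: m.
  exact.
have /choice[h hh] : forall v, exists x : X, (fun m => hs m v) @ \oo --> x.
  by move=> v; apply: (cpl _ (subcode c (pickle v))) => k.
exists h => // v k.
exact: (closed_seq_cvg (cl k _) (ev v k) (hh v)).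
Unshelve. all: by end_near. Qed.

Lemma total_code_ex (V : countType) (h : V -> X) : exists c, total_code h c.
Proof.
case: sB => _ cov _ _.
have /choice[g hg] : forall v, exists c : nat -> nat, forall k, B k (c k) (h v).
  move=> v; have hk k : exists i, B k i (h v) by exact: cov.
  by have [c hc] := choice hk; exists c.
exists (join_codes (fun i => if unpickle i is Some v then g v else id)) => v k.
by rewrite subcode_join pickleK.
Qed.

Definition seq_closed (V : Type) (A : set (V -> X)) : Prop :=
  forall hs h, (\forall m \near \oo, A (hs m)) -> pointwise_cvg hs h -> A h.

Lemma analytic_closed (V : countType) (A : set (V -> X)) :
  seq_closed A -> analytic A.
Proof.
move=> cA; exists (fun h c => total_code h c /\ A h).
  move=> hs cs c Fs csc.
  have [h Fh ch] : exists2 h, total_code h c & pointwise_cvg hs h.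
    by apply: coded_total csc; apply: filterS Fs => m [].
  exists h => //; split => //; apply: cA ch.
  by apply: filterS Fs => m [].
apply/seteqP; split => h /=.
  by move=> Ah; have [c Fc] := total_code_ex h; exists c.
by move=> [c []].
Qed.

Lemma analyticT (V : countType) : analytic [set: V -> X].
Proof. exact: analytic_closed. Qed.

Lemma analytic0 (V : countType) : analytic (set0 : set (V -> X)).
Proof. by apply: analytic_closed => hs h /filter_ex[]. Qed.

(** The subcodes of a limit code give one limit in every [A n], and these limits
    coincide because pointwise limits are unique. *)
Lemma analytic_bigcap (V : Type) (A : nat -> set (V -> X)) :
  (forall n, analytic (A n)) -> analytic (\bigcap_n A n).
Proof.
move=> anA.
have /choice[F hF] : forall n, exists F, coded F /\ A n = [set h | exists c, F h c].
  by move=> n; have [F cF eF] := anA n; exists F.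
exists (fun h c => forall n, F n h (subcode c n)).
  move=> hs cs c Fs csc.
  have lim n : exists2 h, F n h (subcode c n) & pointwise_cvg hs h.
    have [cF _] := hF n.
    apply: (cF hs (fun m => subcode (cs m) n)); last exact: subcode_cvg.
    by apply: filterS Fs => m /(_ n).
  have [h F0 ch] := lim 0%N.
  exists h => // n; have [h' Fh' ch'] := lim n.
  by rewrite (pointwise_cvg_unique ch ch').
apply/seteqP; split => h /=.
  move=> Ah.
  have /choice[c hc] : forall n, exists c, F n h c.
    by move=> n; have := Ah n I; rewrite (proj2 (hF n)).
  by exists (join_codes c) => n; rewrite subcode_join.
move=> [c hc] n _; rewrite (proj2 (hF n)); by exists (subcode c n).
Qed.

Lemma analyticI (V : countType) (A A' : set (V -> X)) :
  analytic A -> analytic A' -> analytic (A `&` A').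
Proof.
move=> aA aA'.
rewrite -bigcap2E; apply: analytic_bigcap => -[|[|n]] //=.
exact: analyticT.
Qed.

Lemma analytic_bigcup (V : Type) (A : nat -> set (V -> X)) :
  (forall n, analytic (A n)) -> analytic (\bigcup_n A n).
Proof.
move=> anA.
have /choice[F hF] : forall n, exists F, coded F /\ A n = [set h | exists c, F h c].
  by move=> n; have [F cF eF] := anA n; exists F.
exists (fun h c => F (c 0%N) h (fun k => c k.+1)).
  move=> hs cs c Fs csc.
  have [cF _] := hF (c 0%N).
  apply: (cF hs (fun m k => cs m k.+1)); last first.
    by move=> k; apply: csc.
  near=> m.
  have <- : cs m 0%N = c 0%N by near: m; apply: csc.
  by near: m.
apply/seteqP; split => h /=.
  move=> [n _]; rewrite (proj2 (hF n)) => -[c hc].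
  by exists (fun k => if k is k'.+1 then c k' else n).
by move=> [c hc]; exists (c 0%N) => //; rewrite (proj2 (hF _)); eexists; exact: hc.
Unshelve. all: by end_near. Qed.

Lemma analytic_image (V : Type) (V' : countType) (v0 : V) (a : V')
    (A : set (V -> X)) :
  analytic A -> analytic [set z : V' -> X | exists2 h, A h & h v0 = z a].
Proof.
move=> [F cF ->].
exists (fun z c => total_code z (subcode c 0) /\
                   exists2 h, F h (subcode c 1) & h v0 = z a).
  move=> zs cs c Fs csc.
  have [z Tz cz] : exists2 z, total_code z (subcode c 0) & pointwise_cvg zs z.
    apply: (@coded_total _ _ (fun m => subcode (cs m) 0)); last exact: subcode_cvg.
    by apply: filterS Fs => m [].
  have [M _ hM] := Fs.
  have /choice[hs hhs] : forall m, exists h : V -> X, (M <= m)%N ->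
      F h (subcode (cs m) 1) /\ h v0 = zs m a.
    move=> m; have [Mm|_] := leqP M m; last first.
      by have [_ [h _ _]] := hM M (leqnn _); exists h.
    by have [_ [h ? ?]] := hM m Mm; exists h.
  have [h Fh ch] : exists2 h, F h (subcode c 1) & pointwise_cvg hs h.
    apply: (cF hs (fun m => subcode (cs m) 1)); last exact: subcode_cvg.
    by exists M => // m /hhs[].
  exists z => //; split => //; exists h => //.
  apply: (@seq_cvg_unique (fun m => hs m v0)); first exact: ch.
  apply: cvg_trans (cz a); apply: near_eq_cvg.
  by exists M => // m /hhs[].
apply/seteqP; split => z /=.
  move=> [h [c hc] e]; have [c0 hc0] := total_code_ex z.
  exists (join_codes (fun n => if n is 0%N then c0 else c)); rewrite !subcode_join.
  by split => //; exists h.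
by move=> [c [_ [h hc e]]]; exists h => //; eexists; exact: hc.
Qed.

Definition bianalytic (V : Type) (A : set (V -> X)) : Prop :=
  analytic A /\ analytic (~` A).

(** Sets that are analytic together with their complement form a sigma-algebra,
    so it is enough to look at open sets. *)
Lemma bianalytic_borel (V : countType) (T : topologicalType) (g : (V -> X) -> T) :
  (forall O, open O -> bianalytic (g @^-1` O)) ->
  forall S, borel S -> bianalytic (g @^-1` S).
Proof.
move=> gO.
have : <<s @open T >> `<=` [set S | bianalytic (g @^-1` S)].
  apply: smallest_sub => //; split.
  - split; rewrite /= preimage_set0 ?setC0; last exact: analyticT.
    exact: analytic0.
  - move=> S [a1 a2]; rewrite /= setTD /bianalytic preimage_setC; split => //.
    by rewrite setCK.
  - move=> S hS; rewrite /= /bianalytic preimage_bigcup setC_bigcup; split.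
      by apply: analytic_bigcup => n; case: (hS n).
    by apply: analytic_bigcap => n; case: (hS n).
exact.
Qed.

Lemma analytic_sieve_set (V : countType) (v : V) k i :
  analytic [set h : V -> X | B k i (h v)].
Proof.
case: sB => cl _ _ _.
apply: analytic_closed => hs h hB /(_ v) ch.
exact: (closed_seq_cvg (cl k i) hB ch).
Qed.

(** The complement is closed under limits; the open set itself is the countable
    union of the products of two closed balls that it contains. *)
Lemma bianalytic_open_pair (V : countType) (a b : V) (O : set (X * X)) :
  open O -> bianalytic [set z : V -> X | O (z a, z b)].
Proof.
move=> oO; split; last first.
  apply: analytic_closed => zs z hz cz.
  have pc : (fun m => (zs m a, zs m b)) @ \oo --> (z a, z b).
    exact: cvg_pair (cz a) (cz b).
  by apply: (closed_seq_cvg (open_closedC oO) hz pc).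
pose P n := if unpickle n is Some (k, i, (l, j)) then
  if `[< B k i `*` B l j `<=` O >] then
    [set z : V -> X | B k i (z a)] `&` [set z : V -> X | B l j (z b)]
  else set0 else set0.
rewrite (_ : [set _ | _] = \bigcup_n P n).
  apply: analytic_bigcup => n; rewrite /P.
  case: (unpickle n : option (nat * nat * (nat * nat))) => [[[k i] [l j]]|].
    case: ifP => _; last exact: analytic0.
    by apply: analyticI; apply: analytic_sieve_set.
  exact: analytic0.
apply/seteqP; split => z /=.
  move=> Oz; case: sB => _ cov _ sm.
  have /= [[U W] /= [Ua Wb] UWO] : nbhs (z a, z b) O by exact: open_nbhs_nbhs.
  have [k hk] := sm _ _ Ua; have [l hl] := sm _ _ Wb.
  have [i hi] := cov k (z a); have [j hj] := cov l (z b).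
  exists (pickle (k, i, (l, j))) => //; rewrite /P pickleK.
  case: asboolP => // -[] [x y] [/= Bx By]; apply: UWO; split => /=.
    exact: hk hi _ Bx.
  exact: hl hj _ By.
move=> [n _]; rewrite /P.
case: (unpickle n : option (nat * nat * (nat * nat))) => [[[k i] [l j]]|//].
by case: asboolP => // BO [? ?]; apply: BO.
Qed.

Lemma bianalytic_pair (V : countType) (a b : V) (S : set (X * X)) :
  borel S -> bianalytic [set z : V -> X | S (z a, z b)].
Proof.
apply: (@bianalytic_borel V _ (fun z : V -> X => (z a, z b))) => O oO.
exact: bianalytic_open_pair.
Qed.

Lemma bianalytic_coord (V : countType) (a : V) (S : set X) :
  borel S -> bianalytic [set z : V -> X | S (z a)].
Proof.
apply: (@bianalytic_borel V _ (fun z : V -> X => z a)) => O oO.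
apply: (@bianalytic_open_pair V a a (fst @^-1` O)).
by apply: open_comp => // -[x y] _; apply: cvg_fst.
Qed.

End Analytic.

(** * Separation and reflection *)
Section BorelSets.
Variable T : topologicalType.

Lemma borelC (A : set T) : borel A -> borel (~` A).
Proof. by move=> bA; rewrite -setTD; apply: sigma_algebraCD. Qed.

Lemma borel_bigcup (A : nat -> set T) :
  (forall i, borel (A i)) -> borel (\bigcup_i A i).
Proof. exact: sigma_algebra_bigcup. Qed.

Lemma borel_bigcap (A : nat -> set T) :
  (forall i, borel (A i)) -> borel (\bigcap_i A i).
Proof.
move=> bA; rewrite -[X in borel X]setCK setC_bigcap.
by apply: borelC; apply: borel_bigcup => i; apply: borelC.
Qed.

Lemma borel_closed (A : set T) : closed A -> borel A.
Proof.
move=> cA; rewrite -[A]setCK; apply: borelC.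
by apply: sub_sigma_algebra; apply: closed_openC.
Qed.

Lemma borelT : borel [set: T].
Proof. exact: borel_closed closedT. Qed.

Lemma borel0 : borel (set0 : set T).
Proof. exact: borel_closed closed0. Qed.

Lemma borelI (A A' : set T) : borel A -> borel A' -> borel (A `&` A').
Proof.
move=> aA aA'.
rewrite -bigcap2E; apply: borel_bigcap => -[|[|n]] //=.
exact: borelT.
Qed.
End BorelSets.

(** Cycles are indexed by all natural numbers, with only the first [p] values
    relevant, so that cycles of every length live in the same space of maps. *)
Definition cycles (X : Type) (R : set (X * X)) (p : nat) : set (nat -> X) :=
  [set z | forall a, (a < p)%N -> R (z a, z (a.+1 %% p))].

Lemma contains_cycleP (X : Type) (R : set (X * X)) (Y : set X) :
  contains_cycle R Y <->
  exists2 p, (0 < p)%N &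
    exists2 z : nat -> X, cycles R p z & forall a, (a < p)%N -> Y (z a).
Proof.
split=> [[n [y [Yy cy]]]|[[//|n] _ [z cz Yz]]].
  exists n.+1 => //; exists (fun a => y (inord a)) => [a an|a an]; last exact: Yy.
  have := cy (inord a); rewrite (_ : ordS _ = inord (a.+1 %% n.+1)) //.
  by apply: val_inj; rewrite /= !inordK // ltn_mod.
exists n, (fun i => z i); split => [i|i]; first exact: Yz.
exact: cz.
Qed.

Section Separation.
Variables (X : topologicalType) (B : nat -> nat -> set X).
Hypotheses (hX : hausdorff_space X) (sB : sieve B).

Definition borel_separated (V V' : Type) (v : V) (v' : V')
    (P : set (V -> X)) (P' : set (V' -> X)) : Prop :=
  exists2 D, borel D &
    (forall h, P h -> D (h v)) /\ (forall h', P' h' -> ~ D (h' v')).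

Lemma borel_separated_bigcup (V V' : Type) (v : V) (v' : V')
    (P : nat -> set (V -> X)) (P' : nat -> set (V' -> X)) :
  (forall i j, borel_separated v v' (P i) (P' j)) ->
  borel_separated v v' (\bigcup_i P i) (\bigcup_j P' j).
Proof.
move=> sep.
have /choice[D hD] : forall ij : nat * nat, exists D : set X,
    [/\ borel D, forall h, P ij.1 h -> D (h v) &
      forall h', P' ij.2 h' -> ~ D (h' v')].
  by move=> [i j]; have [D bD [? ?]] := sep i j; exists D.
exists (\bigcup_i \bigcap_j D (i, j)).
  apply: borel_bigcup => i; apply: borel_bigcap => j.
  by case: (hD (i, j)).
split => [h [i _ Ph]|h' [j _ Ph'] [i _ /(_ j I)]].
  by exists i => // j _; case: (hD (i, j)) => _ /(_ h Ph).
by case: (hD (i, j)) => _ _ /(_ h' Ph').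
Qed.

(** The members of a coded set with a code extending [s]: the analogue of the
    Souslin scheme of an analytic set. *)
Definition code_piece (V : Type) (F : (V -> X) -> (nat -> nat) -> Prop)
    (s : seq nat) : set (V -> X) :=
  [set h | exists2 c, F h c & mkseq c (size s) = s].

Lemma code_piece_bigcup (V : Type) (F : (V -> X) -> (nat -> nat) -> Prop) s :
  code_piece F s = \bigcup_i code_piece F (rcons s i).
Proof.
apply/seteqP; split => h /=.
  move=> [c Fc e]; exists (c (size s)) => //; exists c => //.
  by rewrite size_rcons mkseqS e.
move=> [i _ [c Fc]]; rewrite size_rcons mkseqS => /rcons_inj[e _].
by exists c.
Qed.

(** Codes may be taken to record the value at [v] up to any precision, at known
    positions: adjoin the code of the whole map. *)
Lemma analytic_fine (V : countType) (v : V) (A : set (V -> X)) : analytic A ->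
  exists F (pos : nat -> nat),
    [/\ coded F, A = [set h | exists c, F h c]
      & forall h c k, F h c -> B k (c (pos k)) (h v)].
Proof.
move=> [F cF ->].
exists (fun h c => total_code B h (subcode c 0) /\ F h (subcode c 1)).
exists (fun k => pickle (0, pickle (pickle v, k))); split.
- move=> hs cs c Fs csc.
  have [h Th ch] : exists2 h, total_code B h (subcode c 0) & pointwise_cvg hs h.
    apply: (@coded_total _ _ sB _ hs (fun m => subcode (cs m) 0));
      last exact: subcode_cvg.
    by apply: filterS Fs => m [].
  have [h' Fh' ch'] : exists2 h', F h' (subcode c 1) & pointwise_cvg hs h'.
    apply: (cF hs (fun m => subcode (cs m) 1)); last exact: subcode_cvg.
    by apply: filterS Fs => m [].
  by exists h => //; split => //; rewrite (pointwise_cvg_unique hX ch ch').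
- apply/seteqP; split => h /=; last by move=> [c [_ ?]]; eexists; eassumption.
  move=> [c hc]; have [c0 hc0] := total_code_ex sB h.
  by exists (join_codes (fun n => if n is 0%N then c0 else c)); rewrite !subcode_join.
- by move=> h c k [/(_ v k)].
Qed.

(** If two analytic sets of points cannot be separated, then neither can two
    pieces of them with codes of length 1, since separability passes to
    countable unions.  Iterating produces two codes, each the code of a member;
    these two members have distinct values, and disjoint small balls around the
    values do separate two of the pieces. *)
Theorem lusin_separation (V V' : countType) (v : V) (v' : V')
    (A : set (V -> X)) (A' : set (V' -> X)) :
  analytic A -> analytic A' ->
  (forall h h', A h -> A' h' -> h v <> h' v') -> borel_separated v v' A A'.
Proof.
move=> /(@analytic_fine _ v)[F [pos [cF -> Fpos]]].
move=> /(@analytic_fine _ v')[F' [pos' [cF' -> Fpos']]] dis.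
apply: contrapT => nsep.
pose ns (s : seq nat * seq nat) :=
  ~ borel_separated v v' (code_piece F s.1) (code_piece F' s.2).
have /choice[f hf] : forall s, exists ij : nat * nat,
    ns s -> ns (rcons s.1 ij.1, rcons s.2 ij.2).
  move=> s; have [nss|//] := pselect (ns s); last by exists (0, 0)%N.
  apply: contrapT => no; apply: nss.
  rewrite (code_piece_bigcup F) (code_piece_bigcup F').
  apply: borel_separated_bigcup => i j; apply: contrapT => nij.
  by apply: no; exists (i, j).
pose st n := iter n (fun s => (rcons s.1 (f s).1, rcons s.2 (f s).2)) ([::], [::]).
pose c n := (f (st n)).1; pose c' n := (f (st n)).2.
have stE n : st n = (mkseq c n, mkseq c' n).
  by elim: n => // n IH; rewrite [LHS]/= -/(st n) !mkseqS IH /c /c' /= -IH.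
have nsn n : ns (mkseq c n, mkseq c' n).
  rewrite -stE; elim: n => [|n IH]; last exact: hf IH.
  rewrite /ns /=; apply: contra_not nsep => -[D bD [h1 h2]].
  exists D => //; split => [h [c1 Fc]|h [c1 Fc]]; [apply: h1|apply: h2];
    by exists c1.
have eqc (c1 c2 : nat -> nat) n m : mkseq c1 (size (mkseq c2 n)) = mkseq c2 n ->
    (m < n)%N -> c1 m = c2 m.
  rewrite size_mkseq => e mn.
  by have := congr1 (fun s => nth 0%N s m) e; rewrite /= !nth_mkseq.
have /choice[hc hhc] : forall n, exists hc : (V -> X) * (nat -> nat),
    F hc.1 hc.2 /\ forall j, (j < n)%N -> hc.2 j = c j.
  move=> n; apply: contrapT => no; apply: (nsn n); exists set0; first exact: borel0.
  split => [h [c1 Fc1 e]|h _ []]; case: no; exists (h, c1); split => // j.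
  exact: eqc e.
have /choice[hc' hhc'] : forall n, exists hc : (V' -> X) * (nat -> nat),
    F' hc.1 hc.2 /\ forall j, (j < n)%N -> hc.2 j = c' j.
  move=> n; apply: contrapT => no; apply: (nsn n); exists setT; first exact: borelT.
  split => [//|h [c1 Fc1 e]]; case: no; exists (h, c1); split => // j.
  exact: eqc e.
have [h Fh _] : exists2 h, F h c & pointwise_cvg (fun n => (hc n).1) h.
  apply: (cF _ (fun n => (hc n).2)) => [|k].
    by near=> m; case: (hhc m).
  by exists k.+1 => // m /= km; case: (hhc m) => _; apply.
have [h' Fh' _] : exists2 h, F' h c' & pointwise_cvg (fun n => (hc' n).1) h.
  apply: (cF' _ (fun n => (hc' n).2)) => [|k].
    by near=> m; case: (hhc' m).
  by exists k.+1 => // m /= km; case: (hhc' m) => _; apply.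
apply: (dis h h'); [by exists c|by exists c'|].
apply: hX => U W; case: sB => cl _ _ sm.
move=> /sm[k /(_ _ (Fpos _ _ k Fh)) kU] /sm[k' /(_ _ (Fpos' _ _ k' Fh')) kW].
apply: contrapT => no.
pose n := maxn (pos k).+1 (pos' k').+1.
apply: (nsn n); exists (B k (c (pos k))); first exact: borel_closed.
(* The first [n] digits of the codes in the two pieces determine the balls. *)
split => [h1 [c1 Fc1 e]|h1 [c1 Fc1 e] Bh].
  by rewrite -(eqc _ _ _ _ e) ?leq_max ?leqnn //; apply: Fpos.
case: no; exists (h1 v'); split; first exact: kU.
apply: kW; rewrite -(eqc _ _ _ _ e) ?leq_max ?leqnn ?orbT //; exact: Fpos'.
Unshelve. all: by end_near. Qed.

Lemma analytic_imply (V : countType) (P : Prop) (A : set (V -> X)) :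
  (P -> analytic A) -> analytic [set h | P -> A h].
Proof.
have [p|np] := pselect P => aA.
  by rewrite (_ : [set _ | _] = A); [exact: aA|apply/seteqP; split => h //=; apply].
rewrite (_ : [set _ | _] = setT); first exact: (analyticT sB).
by apply/seteqP; split => h //= _ p; case: np.
Qed.

(** The coordinates of a tuple are treated one after the other: once the first
    [j] of them range over a Borel set [D], the points that can stand at place
    [j] form an analytic set disjoint from [A], and a Borel set separating the
    two allows [D] to be shrunk. *)
Theorem borel_reflection (V : countType) (v0 : V) (A : set (V -> X))
    (C : set (nat -> X)) (p : nat) :
  analytic A -> analytic C ->
  (forall z, C z -> ~ forall a, (a < p)%N -> exists2 h, A h & h v0 = z a) ->
  exists2 D, borel D & (forall h, A h -> D (h v0)) /\
    forall z, C z -> ~ forall a, (a < p)%N -> D (z a).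
Proof.
move=> aA aC no.
suff [D bD [AD DC]] : exists2 D, borel D & (forall h, A h -> D (h v0)) /\
    forall z, C z -> ~ ((forall a, (a < p)%N -> D (z a)) /\
      forall a, (p <= a)%N -> (a < p)%N -> exists2 h, A h & h v0 = z a).
  exists D => //; split => // z Cz Dz; apply: (DC z Cz); split => // a pa.
  by rewrite ltnNge pa.
suff : forall j, (j <= p)%N -> exists2 D, borel D & (forall h, A h -> D (h v0)) /\
    forall z, C z -> ~ ((forall a, (a < j)%N -> D (z a)) /\
      forall a, (j <= a)%N -> (a < p)%N -> exists2 h, A h & h v0 = z a).
  by apply.
elim=> [_|j IH jp].
  exists setT; first exact: borelT.
  by split => // z Cz [_ Az]; apply: (no z Cz) => a; apply: Az.
have [D bD [AD DC]] := IH (ltnW jp).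
pose A' := C `&` \bigcap_a ([set z | (a < j)%N -> D (z a)] `&`
   [set z | (j < a < p)%N -> exists2 h, A h & h v0 = z a]).
have aA' : analytic A'.
  apply: (analyticI hX sB) => //; apply: (analytic_bigcap hX) => // a.
  apply: (analyticI hX sB) => //.
    by apply: analytic_imply => _; case: (bianalytic_coord hX sB a bD).
  by apply: analytic_imply => _; apply: (analytic_image hX sB).
have [D' bD' [AD' A'D']] : borel_separated v0 j A A'.
  apply: lusin_separation => // h z Ah [Cz hz] hj.
  apply: (DC z Cz); split => a; first by case: (hz a I).
  rewrite leq_eqVlt => /orP[/eqP <- _|ja ap]; first by exists h.
  by case: (hz a I) => _; apply; rewrite ja.
exists (D `&` D'); first exact: borelI.
split => [h Ah|z Cz [z1 z2]]; first by split; [exact: AD|exact: AD'].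
apply: (A'D' z); last by case: (z1 j (leqnn _)).
split => // a _; split => /=.
  by move=> aj; case: (z1 a (ltnW aj)).
by move=> /andP[ja ap]; apply: z2.
Qed.

(** Each length of cycles is treated by [borel_reflection], and the resulting
    Borel sets are intersected. *)
Theorem acyclic_reflection (V : countType) (v0 : V) (A : set (V -> X))
    (R : set (X * X)) :
  borel R -> analytic A ->
  ~ contains_cycle R [set x | exists2 h, A h & h v0 = x] ->
  exists2 D, borel D & (forall h, A h -> D (h v0)) /\ ~ contains_cycle R D.
Proof.
move=> bR aA nc.
have aC p : analytic (cycles R p).
  rewrite (_ : cycles R p =
      \bigcap_a [set z | (a < p)%N -> R (z a, z (a.+1 %% p))]).
    apply: (analytic_bigcap hX) => // a; apply: analytic_imply => _.
    by case: (@bianalytic_pair _ _ hX sB _ a (a.+1 %% p)%N _ bR).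
  by apply/seteqP; split => [z cz a _|z cz a] /=; [apply: cz|apply: (cz a I)].
have /choice[D hD] : forall p, exists D : set X,
    [/\ borel D, forall h, A h -> D (h v0) &
     (0 < p)%N -> forall z, cycles R p z -> ~ forall a, (a < p)%N -> D (z a)].
  move=> p; have [p0|_] := ltnP 0 p; last first.
    by exists setT; split => //; exact: borelT.
  have [|D bD [? ?]] := @borel_reflection _ v0 A (cycles R p) p aA (aC p).
    move=> z cz Az; apply: nc; apply/contains_cycleP.
    by exists p => //; exists z.
  by exists D.
exists (\bigcap_p D p); first by apply: borel_bigcap => p; case: (hD p).
split => [h Ah p _|]; first by case: (hD p) => _ /(_ h Ah).
move=> /contains_cycleP[p p0 [z cz Dz]].
case: (hD p) => _ _ /(_ p0 z cz); apply => a ap; exact: (Dz a ap p I).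
Qed.

End Separation.

(** * Minimal cycles and positions in codes *)
Definition min_cycles (X : Type) (R : set (X * X)) (p : nat) : set (nat -> X) :=
  [set z | forall a b, (a < p)%N -> (b < p)%N ->
     R (z a, z b) <-> b = (a.+1 %% p)%N].

Lemma min_cycles_cycles (X : Type) (R : set (X * X)) (p : nat) (z : nat -> X) :
  min_cycles R p z -> cycles R p z.
Proof.
move=> mz a ap; apply/mz => //; rewrite ltn_mod; exact: leq_trans ap.
Qed.

(** A chord from [z a] to [z b] closes up the segment of the cycle from [z b] to
    [z a], which is shorter unless [b] follows [a]. *)
Lemma shortest_cycle_minimal (X : Type) (R : set (X * X)) (p : nat) (z : nat -> X) :
  cycles R p z ->
  (forall q (g : nat -> nat), (0 < q < p)%N ->
     (forall i, (i < q)%N -> (g i < p)%N) -> ~ cycles R q (z \o g)) ->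
  min_cycles R p z.
Proof.
move=> cz short a b ap bp; split=> [Rab|->]; last exact: cz.
have p0 : (0 < p)%N by exact: leq_trans ap.
apply: contrapT => nb.
pose q := ((a + (p - b)) %% p).+1.
have qp : (q < p)%N.
  rewrite ltn_neqAle ltn_mod p0 andbT; apply/eqP => qE; apply: nb.
  have : (b + q = b + ((a + (p - b)) %% p).+1)%N by [].
  move=> /(congr1 (modn^~ p)); rewrite qE modnDr (modn_small bp) addnS -addn1.
  rewrite -modnDml modnDmr addnCA subnKC ?(ltnW bp) // modnDr modnDml addn1.
  by [].
have gl i : (i < q)%N -> ((b + i) %% p < p)%N by rewrite ltn_mod.
apply: (short q (fun i => (b + i) %% p)%N) => // i.
rewrite leq_eqVlt => /orP[/eqP[->]|iq].
  rewrite /= modnn addn0 (modn_small bp) modnDmr addnCA subnKC ?(ltnW bp) //.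
  by rewrite modnDr (modn_small ap).
rewrite /= (modn_small iq) addnS.
have := cz _ (gl i (ltnW iq)).
by rewrite -[((b + i) %% p).+1]addn1 modnDml addn1.
Qed.

Lemma all2_rev (S T : Type) (r : S -> T -> bool) s t :
  size s = size t -> all2 r (rev s) (rev t) = all2 r s t.
Proof. by move=> st; rewrite !all2E !size_rev -rev_zip // all_rev. Qed.

(** The position, in a code, of digit [k] of the code reached from it by taking
    subcodes along the path [t]. *)
Fixpoint subpos (t : seq nat) (k : nat) : nat :=
  if t is i :: t' then pickle (i, subpos t' k) else k.

Lemma subpos_cat t u k : subpos (t ++ u) k = subpos t (subpos u k).
Proof. by elim: t => //= i t ->. Qed.

(** The bound exists because only finitely many paths are allowed; it tells how
    many digits of a code have to be fixed to control its subcodes. *)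
Lemma subpos_bound s N : exists K, forall t k,
  all2 ltn t (take (size t) s) -> (k <= N)%N -> (subpos t k < K)%N.
Proof.
elim: s => [|p s [K IH]].
  by exists N.+1; case => [|? ?] k //=.
exists (maxn N.+1 (\max_(i < p) \max_(y < K) pickle (i : nat, y : nat)).+1).
case => [|i t] k /=; first by rewrite leq_max ltnS => _ ->.
move=> /andP[ip tb] kN; rewrite leq_max ltnS; apply/orP; right.
have yK := IH _ _ tb kN.
pose M (i : 'I_p) := \max_(y < K) pickle (i : nat, y : nat).
apply: leq_trans (@leq_bigmax _ M (Ordinal ip)).
exact: (@leq_bigmax _ (fun y : 'I_K => pickle (i, y : nat)) (Ordinal yK)).
Qed.

Lemma analytic_forall (X : topologicalType) (B : nat -> nat -> set X) :
  hausdorff_space X -> sieve B ->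
  forall (V I : countType) (A : I -> set (V -> X)),
  (forall i, analytic (A i)) -> analytic [set h | forall i, A i h].
Proof.
move=> hX sB V I A aA.
rewrite (_ : [set h | _] = \bigcap_n (if unpickle n is Some i then A i else setT)).
  apply: (analytic_bigcap hX) => n.
  by case: (unpickle n) => [i|]; [exact: aA|exact: (analyticT sB)].
apply/seteqP; split => [h ah n _|h ah i]; first by case: (unpickle n).
by have := ah (pickle i) Logic.I; rewrite pickleK; apply.
Qed.

(** * Large sets of approximations *)

(** An approximation at stage [n] is a map on the vertices of length [n] of the
    tree [T_f], extended arbitrarily to all sequences.  Vertices are stored in
    reverse, newest coordinate first: the part of an approximation of stage
    [n + 1] in the copy number [i] of stage [n] is then [h \o cons i]. *)
Section Large.
Variables (X : topologicalType) (B : nat -> nat -> set X) (R : set (X * X)).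
Hypotheses (hX : hausdorff_space X) (sB : sieve B).
Hypotheses (bR : borel R) (irr : digraph R).

Definition sigma_acyclic (U : set X) : Prop :=
  exists2 A : nat -> set X,
    forall i, borel (A i) /\ ~ contains_cycle R (A i) & U = \bigcup_i A i.

Lemma sigma_acyclic_bigcup (U : nat -> set X) :
  (forall i, sigma_acyclic (U i)) -> sigma_acyclic (\bigcup_i U i).
Proof.
move=> sU.
have /choice[A hA] : forall i, exists A : nat -> set X,
    (forall j, borel (A j) /\ ~ contains_cycle R (A j)) /\ U i = \bigcup_j A j.
  by move=> i; have [A ? ?] := sU i; exists A.
exists (fun n => if unpickle n is Some (i, j) then A i j else set0).
  move=> n; case: (unpickle n : option (nat * nat)) => [[i j]|].
    by case: (hA i).
  split; first exact: borel0.
  by move=> [k [y [/(_ ord0)]]].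
apply/seteqP; split => [x [i _]|x [n _]].
  rewrite (proj2 (hA i)) => -[j _ Ax].
  by exists (pickle (i, j)) => //; rewrite pickleK.
case: (unpickle n : option (nat * nat)) => [[i j]|//] Ax.
by exists i => //; rewrite (proj2 (hA i)); exists j.
Qed.

Lemma sigma_acyclic1 (A : set X) :
  borel A -> ~ contains_cycle R A -> sigma_acyclic A.
Proof.
move=> bA nA; exists (fun _ => A) => //.
by apply/seteqP; split => [x Ax|x [_ _]//]; exists 0%N.
Qed.

Lemma sigma_acyclic0 : sigma_acyclic set0.
Proof. by apply: sigma_acyclic1; [exact: borel0|move=> [k [y [/(_ ord0)]]]]. Qed.

Lemma sigma_acyclicU (U U' : set X) :
  sigma_acyclic U -> sigma_acyclic U' -> sigma_acyclic (U `|` U').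
Proof.
move=> sU sU'.
rewrite -bigcup2E; apply: sigma_acyclic_bigcup => -[|[|n]] //=.
exact: sigma_acyclic0.
Qed.

Lemma sigma_acyclic_borel U : sigma_acyclic U -> borel U.
Proof. by move=> [A hA ->]; apply: borel_bigcup => i; case: (hA i). Qed.

Definition avoids (s : seq nat) (U : set X) (h : seq nat -> X) : Prop :=
  forall v, finite_product s v -> ~ U (h v).

(** Largeness is positivity with respect to the sigma-acyclic sets, lifted from
    points to approximations: the sets that are not large form a sigma-ideal
    ([large_bigcup]). *)
Definition large (s : seq nat) (H : set (seq nat -> X)) : Prop :=
  forall U, sigma_acyclic U -> exists2 h, H h & avoids s U h.

Lemma large_bigcup s (H : nat -> set (seq nat -> X)) :
  large s (\bigcup_i H i) -> exists i, large s (H i).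
Proof.
move=> lH; apply: contrapT => no.
have /choice[U hU] : forall i, exists U, sigma_acyclic U /\
    forall h, H i h -> ~ avoids s U h.
  move=> i; apply: contrapT => noU; apply: no; exists i => U sU.
  apply: contrapT => nh; apply: noU; exists U; split => // h Hh aU.
  by apply: nh; exists h.
have [|h [i _ Hh] ah] := lH (\bigcup_i U i).
  by apply: sigma_acyclic_bigcup => i; case: (hU i).
case: (hU i) => _ /(_ h Hh); apply => v vs Uv.
by apply: (ah v vs); exists i.
Qed.

Lemma large_code_piece s F K : large s (code_piece F [::]) ->
  exists2 t, size t = K & large s (code_piece F t).
Proof.
move=> lF; elim: K => [|K [t st lt]]; first by exists [::].
move: lt; rewrite code_piece_bigcup => /large_bigcup[i li].
by exists (rcons t i); rewrite // size_rcons st.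
Qed.

(** The approximations of stage [n + 1] obtained from [p] approximations of stage
    [n] whose values at the vertex [v0] form a tuple in [C]. *)
Definition amalgam (H : set (seq nat -> X)) (v0 : seq nat) (p : nat)
    (C : set (nat -> X)) : set (seq nat -> X) :=
  [set h : seq nat -> X | (forall i, (i < p)%N -> H (h \o cons i)) /\
           C (fun a => h (a :: v0))].

Definition join_maps (x0 : X) (hs : nat -> seq nat -> X) (v : seq nat) : X :=
  if v is i :: v' then hs i v' else x0.

Lemma avoids_cons p s U h :
  avoids (p :: s) U h <-> forall i, (i < p)%N -> avoids s U (h \o cons i).
Proof.
split=> [a i ip v vs|a [//|i v] /andP[ip vs]].
  by apply: a => /=; apply/andP.
exact: (a i ip v vs).
Qed.

Lemma avoids_sub s U U' h : U `<=` U' -> avoids s U' h -> avoids s U h.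
Proof. by move=> UU a v vs /UU; apply: a. Qed.

(** Suppose that for each [p] some sigma-acyclic [U p] hits all amalgams over a
    cycle of length [p].  The approximations in [H] that avoid all [U p] take at
    [v0] values among which there is no cycle.  These values form an analytic
    set, so they lie in a Borel acyclic set, and adding it to the union of the
    [U p] gives a sigma-acyclic set that hits all of [H]. *)
Lemma large_amalgam_cycles H s v0 : analytic H -> large s H ->
  finite_product s v0 ->
  exists2 p, (0 < p)%N & large (p :: s) (amalgam H v0 p (cycles R p)).
Proof.
move=> aH lH v0s; apply: contrapT => no.
have /choice[U hU] : forall p, exists U, sigma_acyclic U /\
    ((0 < p)%N -> forall h, amalgam H v0 p (cycles R p) h -> ~ avoids (p :: s) U h).
  move=> p; have [p0|_] := ltnP 0 p; last first.
    by exists set0; split => //; exact: sigma_acyclic0.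
  apply: contrapT => noU; apply: no; exists p => // U sU.
  apply: contrapT => nh; apply: noU; exists U; split => // _ h Hh aU.
  by apply: nh; exists h.
pose W := \bigcup_p U p.
have sW : sigma_acyclic W by apply: sigma_acyclic_bigcup => i; case: (hU i).
have aH' : analytic (H `&` avoids s W).
  apply: (analyticI hX sB) => //.
  apply: (analytic_forall hX sB) => v; apply: (analytic_imply sB) => _.
  by case: (bianalytic_coord hX sB v (sigma_acyclic_borel sW)).
have [|D bD [HD nD]] := @acyclic_reflection _ _ hX sB _ v0 _ R bR aH'.
  move=> /contains_cycleP[p p0 [z cz hz]].
  have /choice[hs hhs] : forall a, exists h, (a < p)%N ->
      (H h /\ avoids s W h) /\ h v0 = z a.
    move=> a; have [ap|_] := ltnP a p; first by have [h ? ?] := hz a ap; exists h.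
    by have [h _ _] := lH _ sW; exists h.
  case: (hU p) => sU /(_ p0 (join_maps (z 0) hs)); apply.
    split => [i ip|a ap] /=; first by case: (hhs i ip) => -[].
    have p1 : (a.+1 %% p < p)%N by rewrite ltn_mod.
    by rewrite (proj2 (hhs _ ap)) (proj2 (hhs _ p1)); apply: cz.
  apply/avoids_cons => i ip; case: (hhs i ip) => -[_ aW] _.
  by apply: avoids_sub aW => x Ux; exists p.
have [|h Hh ah] := lH (W `|` D).
  by apply: sigma_acyclicU => //; apply: sigma_acyclic1.
apply: (ah v0 v0s); right; apply: HD; split => //.
by apply: avoids_sub ah => x; left.
Qed.

(** Take [p] least.  For [q < p] all amalgams over cycles of length [q] are hit
    by a sigma-acyclic set; away from the union [U] of these sets there are no
    cycles shorter than [p], and so those of length [p] are minimal. *)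
Lemma large_amalgam_min_cycles H s v0 : analytic H -> large s H ->
  finite_product s v0 ->
  exists p U, [/\ (1 < p)%N, sigma_acyclic U,
    large (p :: s) (amalgam H v0 p (min_cycles R p))
    & forall q (hs : nat -> seq nat -> X), (0 < q < p)%N ->
        (forall i, (i < q)%N -> H (hs i) /\ avoids s U (hs i)) ->
        ~ cycles R q (fun i => hs i v0)].
Proof.
move=> aH lH v0s.
have ex : exists p,
    (0 < p)%N && `[< large (p :: s) (amalgam H v0 p (cycles R p)) >].
  have [p p0 lp] := large_amalgam_cycles aH lH v0s.
  by exists p; rewrite p0; apply/asboolP.
case: (ex_minnP ex) => p /andP[p0 /asboolP lp] pmin.
have /choice[U hU] : forall q, exists U, sigma_acyclic U /\
    ((0 < q < p)%N ->
     forall h, amalgam H v0 q (cycles R q) h -> ~ avoids (q :: s) U h).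
  move=> q; have [/andP[q0 qp]|_] := boolP (0 < q < p)%N; last first.
    by exists set0; split => //; exact: sigma_acyclic0.
  apply: contrapT => noU.
  have : (p <= q)%N; last by rewrite leqNgt qp.
  apply: pmin; rewrite q0; apply/asboolP => U sU.
  apply: contrapT => nh; apply: noU; exists U; split => // _ h Hh aU.
  by apply: nh; exists h.
pose W := \bigcup_p U p.
have sW : sigma_acyclic W by apply: sigma_acyclic_bigcup => i; case: (hU i).
have short q (hs : nat -> seq nat -> X) : (0 < q < p)%N ->
    (forall i, (i < q)%N -> H (hs i) /\ avoids s W (hs i)) ->
    ~ cycles R q (fun i => hs i v0).
  move=> qp hhs cz.
  case: (hU q) => sU /(_ qp (join_maps (hs 0 v0) hs)); apply.
    by split => [i iq|] //=; case: (hhs i iq).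
  apply/avoids_cons => i iq; case: (hhs i iq) => _.
  by apply: avoids_sub => x Ux; exists q.
have lm : large (p :: s) (amalgam H v0 p (min_cycles R p)).
  move=> U' sU'.
  have [h [Hh ch] ah] := lp _ (sigma_acyclicU sU' sW).
  exists h; last by apply: avoids_sub ah => x; left.
  split => //; apply: shortest_cycle_minimal => // q g qp gp.
  apply: (short q (fun i => h \o cons (g i)) qp) => i /gp gip.
  split; first exact: Hh.
  move/avoids_cons: ah => /(_ _ gip); apply: avoids_sub => x; by right.
exists p, W; split => //.
rewrite ltn_neqAle p0 andbT; apply/eqP => p1.
have [h [_]] := lm _ sigma_acyclic0; rewrite -p1 => /min_cycles_cycles.
by move=> /(_ 0%N isT); rewrite modn1 => /irr.
Qed.

Lemma analytic_min_cycles p : analytic (min_cycles R p).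
Proof.
rewrite (_ : min_cycles R p = \bigcap_a \bigcap_b [set z |
   (a < p)%N -> (b < p)%N -> R (z a, z b) <-> b = (a.+1 %% p)%N]); last first.
  apply/seteqP; split => [z mz a _ b _|z mz a b]; first exact: mz.
  exact: (mz a I b I).
apply: (analytic_bigcap hX) => a; apply: (analytic_bigcap hX) => b.
apply: (analytic_imply sB) => _; apply: (analytic_imply sB) => _.
have [a1 a2] := @bianalytic_pair _ _ hX sB _ a b _ bR.
have [e|ne] := pselect (b = (a.+1 %% p)%N).
  rewrite (_ : analytic _ = analytic [set z : nat -> X | R (z a, z b)]) //.
  congr analytic.
  by apply/seteqP; split => z /= => [[_ h]|h]; [exact: h|split].
rewrite (_ : analytic _ = analytic (~` [set z : nat -> X | R (z a, z b)])) //.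
congr analytic.
by apply/seteqP; split => z /= => [[h _] /h|h]; [|split => // /h].
Qed.

(** The code of the whole map is included because the parts of [h] in the [p]
    copies do not cover all sequences. *)
Definition amalgam_code (F : (seq nat -> X) -> (nat -> nat) -> Prop)
    (G : (nat -> X) -> (nat -> nat) -> Prop) (v0 : seq nat) (p : nat)
    (h : seq nat -> X) (c : nat -> nat) : Prop :=
  [/\ total_code B h (subcode c p.+1),
      G (fun a => h (a :: v0)) (subcode c p)
    & forall i, (i < p)%N -> F (h \o cons i) (subcode c i)].

Lemma coded_amalgam F G v0 p : coded F -> coded G -> coded (amalgam_code F G v0 p).
Proof.
move=> cF cG hs cs c Fs csc.
have [h Th ch] : exists2 h, total_code B h (subcode c p.+1) & pointwise_cvg hs h.
  apply: (@coded_total _ _ sB _ hs (fun m => subcode (cs m) p.+1));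
    last exact: subcode_cvg.
  by apply: filterS Fs => m [].
exists h => //; split => //.
  have [z Gz cz] : exists2 z, G z (subcode c p) &
      pointwise_cvg (fun m a => hs m (a :: v0)) z.
    apply: (cG _ (fun m => subcode (cs m) p)); last exact: subcode_cvg.
    by apply: filterS Fs => m [].
  rewrite (_ : (fun a => _) = z) //.
  by apply: (pointwise_cvg_unique hX) cz => a; apply: ch.
move=> i ip.
have [z Fz cz] : exists2 z, F z (subcode c i) &
    pointwise_cvg (fun m => hs m \o cons i) z.
  apply: (cF _ (fun m => subcode (cs m) i)); last exact: subcode_cvg.
  by apply: filterS Fs => m [_ _]; apply.
rewrite (_ : h \o cons i = z) //.
by apply: (pointwise_cvg_unique hX) cz => a; apply: ch.
Qed.

Lemma amalgam_codeP F (G : (nat -> X) -> (nat -> nat) -> Prop) v0 p :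
  amalgam [set h | exists c, F h c] v0 p [set z | exists c, G z c] `<=`
  [set h | exists c, amalgam_code F G v0 p h c].
Proof.
move=> h [Fh [cG hG]].
have /choice[cs hcs] : forall i, exists c, (i < p)%N -> F (h \o cons i) c.
  move=> i; have [/Fh[c hc]|_] := ltnP i p; first by exists c.
  by exists cG.
have [c0 hc0] := total_code_ex sB h.
exists (join_codes
  (fun n => if n == p.+1 then c0 else if n == p then cG else cs n)).
split => [||i ip]; rewrite subcode_join ?eqxx //.
  by rewrite (ltn_eqF (ltnSn p)).
by rewrite (ltn_eqF ip) (ltn_eqF (ltn_trans ip (ltnSn p))); apply: hcs.
Qed.

Lemma coded_restrict F (t : seq nat) : coded F ->
  coded (fun (h : seq nat -> X) c => F h c /\ mkseq c (size t) = t).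
Proof.
move=> cF hs cs c Fs csc.
have [h Fh ch] : exists2 h, F h c & pointwise_cvg hs h.
  by apply: (cF _ _ _ _ csc); apply: filterS Fs => m [].
exists h => //; split => //.
apply: (@eq_from_nth _ 0%N); rewrite size_mkseq // => j jt.
rewrite nth_mkseq //.
have [m [[_ e] <-]] := filter_ex (filterI Fs (csc j)).
by rewrite -e nth_mkseq // e.
Qed.

(** One stage of the construction.  The digits of the codes are fixed up to [K]
    at the expense of passing to a large piece. *)
Lemma large_step s F v0 (K : seq nat -> nat) :
  coded F -> large s [set h | exists c, F h c] -> finite_product s v0 ->
  exists p F' t U,
    [/\ (1 < p)%N, coded F', large (p :: s) [set h | exists c, F' h c],
        forall h c, F' h c ->
          [/\ mkseq c (K (p :: s)) = t,
              forall i, (i < p)%N -> F (h \o cons i) (subcode c i)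
            & min_cycles R p (fun a => h (a :: v0))]
      & sigma_acyclic U /\
        forall q (hs : nat -> seq nat -> X), (0 < q < p)%N ->
        (forall i, (i < q)%N -> (exists c, F (hs i) c) /\ avoids s U (hs i)) ->
        ~ cycles R q (fun i => hs i v0)].
Proof.
move=> cF lF v0s.
have aF : analytic [set h | exists c, F h c] by exists F.
have [p [U [p1 sU lp short]]] := large_amalgam_min_cycles aF lF v0s.
have [G cG eG] := analytic_min_cycles p.
have lG : large (p :: s) (code_piece (amalgam_code F G v0 p) [::]).
  move=> U' sU'; have [h Hh ah] := lp U' sU'; exists h => //.
  move: Hh; rewrite eG => /amalgam_codeP[c hc].
  by exists c.
have [t st lt] := large_code_piece (K (p :: s)) lG.
exists p, (fun h c => amalgam_code F G v0 p h c /\ mkseq c (size t) = t), t, U.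
split => //.
- by apply: coded_restrict; apply: coded_amalgam.
- move=> U' sU'; have [h [c Fc e] ah] := lt U' sU'; exists h => //.
  by exists c.
- move=> h c [[_ Gc Fc] e]; split => //; first by rewrite -st.
  by rewrite eG; eexists; exact: Gc.
Qed.

(** The outcome of the construction.  [tower_digits] makes the codes of stage
    [n + 1] agree on the first [K] digits, which drives the passage to the
    limit; [tower_short] says that cycles shorter than [f n] are confined to
    approximations that meet a fixed sigma-acyclic set. *)
Record tower (E : seq nat -> seq nat) (K : seq nat -> nat) (f : nat -> nat)
    (F : nat -> (seq nat -> X) -> (nat -> nat) -> Prop) : Prop := Tower {
  tower_calF : calF f;
  tower_coded n : coded (F n);
  tower_large n : large (rev (restr f n)) [set h | exists c, F n h c];
  tower_0 : F 0%N = total_code B (V := seq nat);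
  tower_sub n h c : F n.+1 h c ->
    forall i, (i < f n)%N -> F n (h \o cons i) (subcode c i);
  tower_cycle n h c : F n.+1 h c ->
    min_cycles R (f n) (fun a => h (a :: rev (E (restr f n))));
  tower_digits n : exists t, forall h c, F n.+1 h c ->
    mkseq c (K (rev (restr f n.+1))) = t;
  tower_short n : exists2 U, sigma_acyclic U &
    forall q (hs : nat -> seq nat -> X), (0 < q < f n)%N ->
    (forall i, (i < q)%N -> (exists c, F n (hs i) c) /\
                            avoids (rev (restr f n)) U (hs i)) ->
    ~ cycles R q (fun i => hs i (rev (E (restr f n)))) }.

(** The construction starts from the set of all maps, which is large because
    a sigma-acyclic set is not all of [X] and so is avoided by a constant map. *)
Lemma tower_exists (E : seq nat -> seq nat) (K : seq nat -> nat) :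
  selector E -> ~ sigma_acyclic setT ->
  exists f F, tower E K f F.
Proof.
move=> sE nX.
pose St : Type := (seq nat * ((seq nat -> X) -> (nat -> nat) -> Prop))%type.
pose good (st : St) := [/\ all (leq 2) st.1, coded st.2 &
  large st.1 [set h | exists c, st.2 h c]].
pose v0 (st : St) := rev (E (rev st.1)).
pose step (st st' : St) := exists p, [/\ st'.1 = p :: st.1,
   forall h c, st'.2 h c ->
     (forall i, (i < p)%N -> st.2 (h \o cons i) (subcode c i)) /\
     min_cycles R p (fun a => h (a :: v0 st)),
   exists t, forall h c, st'.2 h c -> mkseq c (K (p :: st.1)) = t &
   exists2 U, sigma_acyclic U &
        forall q (hs : nat -> seq nat -> X), (0 < q < p)%N ->
        (forall i, (i < q)%N ->
           (exists c, st.2 (hs i) c) /\ avoids st.1 U (hs i)) ->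
        ~ cycles R q (fun i => hs i (v0 st))].
have /choice[nx hnx] : forall st, exists st', good st -> good st' /\ step st st'.
  move=> [s F].
  have [[/= as_ cF lF]|?] := pselect (good (s, F)); last by exists (s, F).
  have v0s : finite_product s (v0 (s, F)).
    have /sE : calF_fin (rev s) by rewrite /calF_fin /= all_rev.
    move=> Es; rewrite /finite_product /v0 /= -[s in all2 _ _ s]revK all2_rev //.
    by move: Es; rewrite /finite_product /= all2E => /andP[/eqP].
  have [p [F' [t [U [p1 cF' lF' F'P [sU short]]]]]] := large_step K cF lF v0s.
  exists (p :: s, F') => _; split; first by split => //=; rewrite p1.
  exists p; split => //.
  - by move=> h c /F'P[].
  - by exists t => h c /F'P[].
  - by exists U.
pose st n := iter n nx ([::], total_code B (V := seq nat)).
have gst n : good (st n).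
  elim: n => [|n IH]; last by case: (hnx _ IH).
  split => //=; first exact: coded_total.
  move=> U sU.
  have [x nUx] : exists x, ~ U x.
    apply: contrapT => noU; apply: nX; rewrite (_ : setT = U) //.
    by apply/seteqP; split => x // _; apply: contrapT => nUx; apply: noU; exists x.
  have [c hc] := total_code_ex sB (fun _ : seq nat => x).
  by exists (fun _ => x); [exists c|move=> v _].
have sst n : step (st n) (st n.+1) by case: (hnx _ (gst n)).
pose f n := head 0%N (st n.+1).1.
have stS n : (st n.+1).1 = f n :: (st n).1.
  by have [p [e _ _ _]] := sst n; rewrite /f e.
have st1 n : (st n).1 = rev (restr f n).
  elim: n => // n IH; rewrite stS IH /restr mkseqS rev_rcons //.
exists f, (fun n => (st n).2); split => //.
- move=> k; case: (gst k.+1) => + _ _; rewrite stS /=.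
  by case/andP.
- by move=> n; case: (gst n).
- by move=> n; rewrite -st1; case: (gst n).
- move=> n h c hF i; case: (sst n) => p [].
  by rewrite stS => -[->] /(_ h c hF)[+ _] _ _; apply.
- move=> n h c hF; case: (sst n) => p [].
  by rewrite stS => -[->] /(_ h c hF)[_ +] _ _; rewrite /v0 st1 revK.
- move=> n; case: (sst n) => p [].
  by rewrite -st1 stS => -[->] _ + _.
- move=> n; case: (sst n) => p [].
  by rewrite stS => -[->] _ _; rewrite /v0 st1 revK.
Qed.

End Large.

(** * The limit of the approximations *)

Fixpoint segment (x : nat -> nat) (m d : nat) : seq nat :=
  if d is d'.+1 then x (m + d')%N :: segment x m d' else [::].

Lemma size_segment x m d : size (segment x m d) = d.
Proof. by elim: d => //= d ->. Qed.

Lemma segment_cat x m d e :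
  segment x m (d + e) = segment x (m + d) e ++ segment x m d.
Proof. by elim: e => [|e IH]; rewrite ?addn0 // addnS /= IH addnA. Qed.

Lemma segment0 x n : segment x 0 n = rev (restr x n).
Proof. by elim: n => //= n ->; rewrite /restr mkseqS rev_rcons. Qed.

Lemma eq_segment x y m d : (forall j, (m <= j < m + d)%N -> x j = y j) ->
  segment x m d = segment y m d.
Proof.
elim: d => //= d IH xy; rewrite xy ?IH // => [j /andP[mj jd]|].
  by apply: xy; rewrite mj addnS ltnW.
by rewrite leq_addr addnS /=.
Qed.

Lemma rev_restrS f n : rev (restr f n.+1) = f n :: rev (restr f n).
Proof. by rewrite /restr mkseqS rev_rcons. Qed.

Lemma all2_catl (S T : Type) (r : S -> T -> bool) u v s :
  all2 r (u ++ v) s -> all2 r u (take (size u) s).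
Proof. by elim: u s => [|i u IH] [|p s] //= /andP[-> /IH]. Qed.

Lemma all2_segment f x m d : (forall j, (x j < f j)%N) ->
  all2 ltn (segment x m d) (take d (rev (restr f (m + d)))).
Proof.
by move=> xf; elim: d => [|d IH]; rewrite ?take0 // addnS rev_restrS /= xf.
Qed.

Lemma selector_restr E f l : selector E -> calF f ->
  finite_product (restr f l) (E (restr f l)).
Proof.
move=> sE hf; apply: sE; rewrite /calF_fin /=; apply/allP => y /mapP[k _ ->].
exact: hf.
Qed.

Lemma size_selector E f l : selector E -> calF f -> size (E (restr f l)) = l.
Proof.
move=> sE hf; have := selector_restr l sE hf.
by rewrite /finite_product /= all2E => /andP[/eqP -> _]; rewrite size_mkseq.
Qed.
Section Limit.
Variables (X : topologicalType) (B : nat -> nat -> set X) (R : set (X * X)).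
Hypotheses (hX : hausdorff_space X) (sB : sieve B) (irr : digraph R).
Variables (E : seq nat -> seq nat) (K : seq nat -> nat) (f : nat -> nat).
Variable F : nat -> (seq nat -> X) -> (nat -> nat) -> Prop.
Hypothesis sE : selector E.
Hypothesis hK : forall s t k, all2 ltn t (take (size t) s) ->
  (k <= size s)%N -> (subpos t k < K s)%N.
Hypothesis tw : tower B R E K f F.

Let Er n := rev (E (restr f n)).
Let hf : calF f := tower_calF tw.

Lemma tower_sub_cat m t h c :
  all2 ltn t (take (size t) (rev (restr f (m + size t)))) ->
  F (m + size t) h c ->
  F m (fun v => h (t ++ v)) (fun k => c (subpos t k)).
Proof.
elim: t h c => [|i t IH] h c; first by rewrite addn0.
rewrite /= addnS rev_restrS => /andP[ip tb] Fh.
exact: (IH _ _ tb (tower_sub tw Fh ip)).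
Qed.

Lemma avoids_cat m t U (h : seq nat -> X) :
  all2 ltn t (take (size t) (rev (restr f (m + size t)))) ->
  avoids (rev (restr f (m + size t))) U h ->
  avoids (rev (restr f m)) U (fun v => h (t ++ v)).
Proof.
elim: t h => [|i t IH] h; first by rewrite addn0.
rewrite /= addnS rev_restrS => /andP[ip tb] /avoids_cons/(_ i ip).
exact: IH tb.
Qed.

(** An approximation of stage [n + 1] carries a cycle of length [f n] at the
    vertex [E (restr f n)], whose first [m] coordinates are [E (restr f m)].
    Its restrictions to stage [m] carry the same cycle at [E (restr f m)]; if the
    approximation avoids the sigma-acyclic set that [tower_short] attaches to
    stage [m], that cycle has length at least [f m]. *)
Lemma tower_monotone n m :
  prefix (E (restr f m)) (E (restr f n)) -> (f m <= f n)%N.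
Proof.
move=> /prefixP[t Et].
have nm : n = (m + size t)%N.
  by have := congr1 size Et; rewrite size_cat !size_selector.
rewrite leqNgt; apply/negP => fnm.
have [U sU short] := tower_short tw m.
have [h [c Fh] ah] := tower_large tw n.+1 sU.
have fn0 : (0 < f n)%N by exact: leq_trans (tower_calF tw n).
have tb a : (a < f n)%N ->
    all2 ltn (a :: rev t) (take (size (a :: rev t)) (rev (restr f n.+1))).
  move=> an; rewrite rev_restrS /= an /=.
  apply: (@all2_catl _ _ _ _ (Er m)); rewrite /Er -rev_cat -Et.
  by rewrite all2_rev ?size_selector ?size_mkseq //; exact: selector_restr.
have nS a : n.+1 = (m + size (a :: rev t))%N by rewrite /= size_rev addnS nm.
apply: (short (f n) (fun a v => h ((a :: rev t) ++ v))).
- by rewrite fn0.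
- move=> a an; have := tb a an; rewrite (nS a) => tba; split.
    exists (fun k => c (subpos (a :: rev t) k)).
    by apply: tower_sub_cat => //; rewrite -nS.
  by apply: avoids_cat => //; rewrite -nS.
- have := min_cycles_cycles (tower_cycle tw Fh).
  by rewrite Et rev_cat.
Qed.

Lemma witness_exists : exists hc : nat -> (seq nat -> X) * (nat -> nat),
  forall n, F n (hc n).1 (hc n).2.
Proof.
have /choice[hc hhc] : forall n, exists hc : (seq nat -> X) * (nat -> nat),
    F n hc.1 hc.2.
  move=> n; have [h [c hc] _] := tower_large tw n (sigma_acyclic0 R).
  by exists (h, c).
by exists hc.
Qed.

Variable hc : nat -> (seq nat -> X) * (nat -> nat).
Hypothesis Fhc : forall n, F n (hc n).1 (hc n).2.

(* The restriction of the chosen approximation of stage [m + d] to stage [m]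
   along the branch [x], and its code; [lcode] is the limit of these codes. *)
Let approx x m d : seq nat -> X := fun v => (hc (m + d)).1 (segment x m d ++ v).
Let acode x m d : nat -> nat := fun k => (hc (m + d)).2 (subpos (segment x m d) k).
Let lcode x m : nat -> nat := fun k => acode x m k.+1 k.
Let bounded (x : nat -> nat) := forall j, (x j < f j)%N.

Lemma approx_code x m d : bounded x -> F m (approx x m d) (acode x m d).
Proof.
move=> bx; have Fd := Fhc (m + d).
have := @tower_sub_cat m (segment x m d) (hc (m + d)).1 (hc (m + d)).2.
by rewrite size_segment; apply => //; apply: all2_segment.
Qed.

(** Both codes come from codes of stage [m + d], read at the same position, and
    enough digits of the codes of that stage have been fixed. *)
Lemma acode_stable x m d e k : bounded x -> (0 < m + d)%N -> (k <= m + d)%N ->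
  acode x m (d + e) k = acode x m d k.
Proof.
move=> bx md0 kd.
rewrite /acode addnA segment_cat subpos_cat.
have kK : (subpos (segment x m d) k < K (rev (restr f (m + d))))%N.
  apply: hK; last by rewrite size_rev size_mkseq.
  by rewrite size_segment; apply: all2_segment.
have := approx_code (m + d) e bx; rewrite /approx /acode.
have := Fhc (m + d); move: md0 kK; case: (m + d)%N => // n _ kK F1 F2.
have [t ht] := tower_digits tw n.
have e1 := ht _ _ F1; have e2 := ht _ _ F2; rewrite -e2 in e1.
have := congr1 (fun s => nth 0%N s (subpos (segment x m d) k)) e1.
by rewrite /= !nth_mkseq.
Qed.

Lemma acode_cvg x m : bounded x -> code_cvg (acode x m) (lcode x m).
Proof.
move=> bx k; exists k.+1 => // d /= /subnKC <-.
by apply: acode_stable => //; rewrite addnS // ltnW // ltnS leq_addl.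
Qed.

Lemma approx_cvg x m : bounded x ->
  exists2 h, F m h (lcode x m) & pointwise_cvg (approx x m) h.
Proof.
move=> bx; have cF := @tower_coded _ _ _ _ _ _ _ tw m.
apply: (cF (approx x m) (acode x m)); last exact: acode_cvg.
by near=> d; apply: approx_code.
Unshelve. all: by end_near. Qed.

(** The value at [x] is the limit of the values at the root of the restrictions
    to stage 0, at which a code is a list of balls containing the value. *)
Lemma limit_map_exists : exists Pi : (nat -> nat) -> X, forall x, bounded x ->
  (fun d => approx x 0 d [::]) @ \oo --> Pi x /\
  forall k, B k (lcode x 0 (pickle (pickle ([::] : seq nat), k))) (Pi x).
Proof.
have /choice[h hh] : forall x, exists h, bounded x ->
    F 0 h (lcode x 0) /\ pointwise_cvg (approx x 0) h.
  move=> x; have [bx|nbx] := pselect (bounded x).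
    by have [h ? ?] := approx_cvg 0 bx; exists h.
  by exists (hc 0).1.
exists (fun x => h x [::]) => x bx; have [Fx cx] := hh x bx.
split => [|k]; first exact: cx.
by move: Fx; rewrite (tower_0 tw) => /(_ [::] k).
Qed.

Variable Pi : (nat -> nat) -> X.
Hypothesis hPi : forall x, bounded x ->
  (fun d => approx x 0 d [::]) @ \oo --> Pi x /\
  forall k, B k (lcode x 0 (pickle (pickle ([::] : seq nat), k))) (Pi x).

(** Digit [k] of the limit code depends on the first [k + 1] coordinates of the
    branch only, so branches that agree far enough have limits in a common small
    ball. *)
Lemma limit_map_modulus x (U : set X) : bounded x -> nbhs (Pi x) U ->
  exists n, forall y, bounded y -> (forall j, (j < n)%N -> y j = x j) -> U (Pi y).
Proof.
move=> bx; case: sB => _ _ _ sm /sm[k kU].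
pose pos := pickle (pickle ([::] : seq nat), k).
exists pos.+1 => y bY yx.
apply: (kU _ (proj2 (hPi bx) k)).
have <- : lcode y 0 pos = lcode x 0 pos; last exact: (proj2 (hPi bY) k).
rewrite /lcode /acode (@eq_segment y x) // => j /andP[_]; exact: yx.
Qed.

(** The limit [h] of the restrictions to stage [l + 1] along the common tail [w]
    is again an approximation of stage [l + 1], so its values at the vertices
    [a :: rev (E (restr f l))] form a minimal cycle; these values are the limits
    at the branches [xs a]. *)
Lemma limit_map_cycle l (w : nat -> nat) (xs : nat -> nat -> nat) :
  bounded w ->
  (forall a, (a < f l)%N -> [/\ restr (xs a) l = E (restr f l), xs a l = a
     & forall k, (l < k)%N -> xs a k = w k]) ->
  (forall a, (a < f l)%N -> bounded (xs a)) ->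
  min_cycles R (f l) (fun a => Pi (xs a)).
Proof.
move=> bw hxs bxs.
have [h Fh ch] := approx_cvg l.+1 bw.
have hE a : (a < f l)%N -> h (a :: Er l) = Pi (xs a).
  move=> al; apply: (seq_cvg_unique hX (ch _)).
  have [cx _] := hPi (bxs a al); have [xE xl xw] := hxs a al.
  move=> U /cx[N _ hN]; exists N => // d /= Nd.
  have := hN (l.+1 + d)%N (leq_trans Nd (leq_addl _ _)).
  rewrite /approx /preimage /mkset cats0 add0n segment_cat add0n.
  rewrite (@eq_segment (xs a) w); last first.
    by move=> j /andP[lj _]; apply: xw.
  by rewrite segment0 rev_restrS xl xE.
move=> a b al bl; rewrite -(hE a al) -(hE b bl).
exact: (tower_cycle tw Fh).
Qed.

End Limit.

(** * The graph on branches *)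
Section Branches.
Variable f : nat -> nat.

Definition agree (n : nat) (y y' : branches f) : Prop :=
  forall j, (j < n)%N -> branch_val y' j = branch_val y j.

Lemma nbhs_agree n (y : branches f) : nbhs y (agree n y).
Proof.
elim: n => [|n IH]; first by apply: filterS (filterT : nbhs y setT) => y' _ j.
have : nbhs y [set y' : branches f | y' n = y n].
  have pc := @proj_continuous nat (fun k => discrete_topology 'I_(f k)) n y.
  by apply: (pc [set y n]); apply: discrete_set1.
move=> /(filterI IH); apply: filterS => y' [h1 /= h2] j.
rewrite ltnS leq_eqVlt => /orP[/eqP ->|]; last exact: h1.
by rewrite /branch_val h2.
Qed.

End Branches.

Lemma all2_nth (S T : Type) (r : S -> T -> bool) x0 y0 s t k :
  all2 r s t -> (k < size s)%N -> r (nth x0 s k) (nth y0 t k).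
Proof.
elim: s t k => [|x s IH] [|y t] [|k] //= /andP[] //.
by move=> _ /IH; apply.
Qed.

(** For [a < f l] the branches [splice (E (restr f l)) a w] run through a basic
    cycle of the graph, [w] giving the coordinates after [l]. *)
Definition splice (e : seq nat) (a : nat) (w : nat -> nat) (k : nat) : nat :=
  if (k < size e)%N then nth 0%N e k else if k == size e then a else w k.

Lemma spliceE e a (y w : nat -> nat) :
  restr y (size e) = e -> y (size e) = a ->
  (forall k, (size e < k)%N -> y k = w k) -> y = splice e a w.
Proof.
move=> ye ya yw; apply/funext => k; rewrite /splice; case: ltngtP => [ks|ks|->//].
  by rewrite -[in RHS]ye nth_mkseq.
exact: yw.
Qed.

Lemma splice_restr e a w : restr (splice e a w) (size e) = e.
Proof.
apply: (@eq_from_nth _ 0%N); rewrite size_mkseq // => k ks.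
by rewrite nth_mkseq // /splice ks.
Qed.

Lemma splice_at e a w : splice e a w (size e) = a.
Proof. by rewrite /splice ltnn eqxx. Qed.

Lemma splice_gt e a w k : (size e < k)%N -> splice e a w k = w k.
Proof. by move=> ek; rewrite /splice ltnNge (ltnW ek) gtn_eqF. Qed.

Section Graph.
Variables (E : seq nat -> seq nat) (f : nat -> nat).
Hypotheses (sE : selector E) (hf : calF f).

Let El l := E (restr f l).

Lemma size_El l : size (El l) = l.
Proof. exact: size_selector. Qed.
Lemma splice_bounded l a w : (a < f l)%N -> (forall k, (w k < f k)%N) ->
  forall k, (splice (El l) a w k < f k)%N.
Proof.
move=> al wf k; rewrite /splice size_El; case: (ltngtP k l) => [kl|//|->//].
have := @all2_nth _ _ ltn 0%N 0%N _ _ k (selector_restr l sE hf).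
by rewrite size_El nth_mkseq //; apply.
Qed.

Lemma splice_El l a w :
  restr (splice (El l) a w) l = El l /\ splice (El l) a w l = a.
Proof.
have := splice_restr (El l) a w; have := splice_at (El l) a w.
by rewrite size_El.
Qed.

Definition edge_at (l : nat) (y z : nat -> nat) : Prop :=
  [/\ restr y l = El l, restr z l = El l, z l = ((y l).+1 %% f l)%N
    & forall k, (l < k)%N -> z k = y k].

Lemma G0P (y z : branches f) :
  G0 E f (y, z) <-> exists l, edge_at l (branch_val y) (branch_val z).
Proof.
have sc l a x : scat (El l ++ [:: a]) x = splice (El l) a (fun k => x (k - l.+1)%N).
  apply/funext => k.
  rewrite /scat /splice size_cat size_El addn1 ltnS nth_cat size_El.
  by case: ltngtP => // ->; rewrite subnn.
split=> [[l [x [zl]]]|[l [yE zE zl yz]]].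
  rewrite !sc addn1 in zl * => Ey Ez; exists l; split=> //.
  - by rewrite Ey; case: (splice_El l (branch_val y l) (fun k => x (k - l.+1)%N)).
  - by rewrite Ez; case: (splice_El l (branch_val z l) (fun k => x (k - l.+1)%N)).
  - by move=> k lk; rewrite Ez Ey !splice_gt ?size_El.
exists l, (fun k => branch_val y (k + l.+1)%N); rewrite addn1 !sc; split => //.
  by apply: spliceE; rewrite size_El // => k lk; rewrite subnK.
by apply: spliceE; rewrite size_El // => k lk; rewrite subnK // yz.
Qed.

Lemma branch_val_inj : injective (@branch_val f).
Proof.
move=> y z yz; apply: functional_extensionality_dep => k.
by apply: val_inj; have := congr1 (fun g => g k) yz.
Qed.

Lemma minimal_cycle_inj (X : Type) (R : set (X * X)) n (x : 'I_n.+1 -> X) :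
  is_minimal_cycle R x -> injective x.
Proof.
move=> [cx mx] i j ij; apply: (@ordS_inj n.+1).
by apply/esym; apply/mx; rewrite ij; apply: cx.
Qed.

(** The graph is tree-like apart from its basic cycles.  Let [L] be the largest
    level of an edge of the cycle.  After an edge of level [L] the cycle is at a
    vertex with initial part [E (restr f L)]; lower edges do not change the
    coordinates from [L] on, and the next edge of level [L] has to start at a
    vertex with the same initial part, hence at the same vertex.  By
    injectivity there are no lower edges in between, so all edges have level
    [L]. *)
Lemma injective_cycle_block n (z : 'I_n.+1 -> branches f) :
  is_cycle (G0 E f) z -> injective z ->
  exists l, forall i, restr (branch_val (z i)) l = El l /\
    forall k, (l < k)%N -> branch_val (z i) k = branch_val (z ord0) k.
Proof.
move=> cz zinj.
have /choice[lv hlv] : forall i, exists l,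
    edge_at l (branch_val (z i)) (branch_val (z (ordS i))).
  by move=> i; apply/G0P; apply: cz.
pose o t : 'I_n.+1 := inord (t %% n.+1).
have oS t : ordS (o t) = o t.+1.
  apply: val_inj; rewrite /= !inordK ?ltn_mod //.
  by rewrite -addn1 modnDml addn1.
have oD t : o (t + n.+1)%N = o t by rewrite /o modnDr.
pose zz t := branch_val (z (o t)).
have ed t : edge_at (lv (o t)) (zz t) (zz t.+1).
  by rewrite /zz -oS; apply: hlv.
pose i0 := [arg max_(i > ord0) lv i]; pose L := lv i0.
have Lmax i : (lv i <= L)%N.
  by rewrite /L /i0; case: arg_maxnP => // j _; apply.
have o0 : o i0 = i0 by apply: val_inj; rewrite /= inordK modn_small.
have next t : lv (o t) = L -> lv (o t.+1) = L.
  move=> tL.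
  have ex : exists j, (t < j)%N && (lv (o j) == L).
    by exists (t + n.+1)%N; rewrite oD tL eqxx andbT addnS ltnS leq_addr.
  case: (ex_minnP ex) => j /andP[tj /eqP jL] jmin.
  have jle : (j <= t + n.+1)%N.
    by apply: jmin; rewrite oD tL eqxx andbT addnS ltnS leq_addr.
  have stay d : (t.+1 + d <= j)%N ->
      forall k, (L <= k)%N -> zz (t.+1 + d)%N k = zz t.+1 k.
    elim: d => [|d IH] dj k Lk; first by rewrite addn0.
    rewrite addnS in dj *; rewrite -(IH (ltnW dj) k Lk).
    have [_ _ _ ->//] := ed (t.+1 + d)%N.
    apply: leq_trans Lk; rewrite ltn_neqAle Lmax andbT; apply/negP => eL.
    have := jmin (t.+1 + d)%N; rewrite eL andbT ltn_addr // => /(_ isT).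
    by rewrite leqNgt dj.
  have zj : zz j = zz t.+1.
    have [_ tE _ _] := ed t; have [jE _ _ _] := ed j.
    rewrite tL in tE; rewrite jL in jE.
    apply/funext => k; have [kL|Lk] := ltnP k L.
      have := congr1 (fun s => nth 0%N s k) (etrans jE (esym tE)).
      by rewrite !nth_mkseq.
    by have := stay (j - t.+1)%N; rewrite subnKC //; apply.
  have /zinj oj : z (o j) = z (o t.+1) by apply: branch_val_inj.
  have jt : (j - t.+1)%N = 0%N.
    apply/eqP; rewrite -leqn0 leqNgt; apply/negP => pos.
    have : (n.+1 %| j - t.+1)%N.
      rewrite -eqn_mod_dvd //.
      by have := congr1 val oj; rewrite /= !inordK ?ltn_mod // => ->.
    move=> /(dvdn_leq pos); rewrite leqNgt => /negP; apply.
    by rewrite ltn_subLR // addSn addnS ltnS -addnS.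
  by rewrite -(subnKC tj) jt addn0 in jL.
have allL t : lv (o t) = L.
  have : lv (o (i0 + t + (i0 * n))%N) = L.
    rewrite -addnA; elim: (t + _)%N => [|d IH]; first by rewrite addn0 o0.
    by rewrite addnS; apply: next.
  by rewrite addnAC -mulnS /o modnMDl.
have os i : o (val i) = i by apply: val_inj; rewrite /= inordK modn_small.
exists L => i.
have [iE _ _ _] := ed i; rewrite allL /zz os in iE; split => // k Lk.
have tail t : zz t k = zz 0%N k.
  elim: t => // t <-; have [_ _ _ ->//] := ed t.
  by rewrite allL.
by have := tail i; rewrite /zz os (_ : o 0%N = ord0) //; apply: (os ord0).
Qed.

End Graph.

Section Existence.
Variables (X : topologicalType) (B : nat -> nat -> set X) (R : set (X * X)).
Hypotheses (hX : hausdorff_space X) (sB : sieve B).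
Hypotheses (bR : borel R) (irr : digraph R).

Theorem homomorphism_exists (E : seq nat -> seq nat) :
  ~ sigma_acyclic R setT -> selector E ->
  exists2 f : nat -> nat, calF f &
    (forall n m : nat,
       prefix (E (restr f m)) (E (restr f n)) -> (f m <= f n)%N) /\
    (exists Pi : branches f -> X,
       continuous Pi /\ minimal_homomorphism (G0 E f) R Pi).
Proof.
move=> nX sE.
have /choice[K hK] : forall s : seq nat, exists K, forall t k,
    all2 ltn t (take (size t) s) -> (k <= size s)%N -> (subpos t k < K)%N.
  by move=> s; exact: subpos_bound.
have [f [F tw]] := tower_exists hX sB bR irr K sE nX.
have hf := tower_calF tw; exists f => //; split; first exact: tower_monotone sE tw.
have [hc Fhc] := witness_exists tw.
have [P hP] := limit_map_exists hK tw Fhc.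
exists (fun y => P (branch_val y)).
have by_ (y : branches f) j : (branch_val y j < f j)%N by exact: ltn_ord.
have cyc l (w : branches f) :
    min_cycles R (f l) (fun a => P (splice (E (restr f l)) a (branch_val w))).
  have sl := size_El sE hf l.
  apply: (limit_map_cycle hX hK tw Fhc hP (by_ w)) => a al; last first.
    exact: splice_bounded.
  have [e1 e2] := splice_El sE hf l a (branch_val w); split => // k lk.
  by apply: splice_gt; rewrite sl.
split; last split.
- move=> y U /(limit_map_modulus sB hP (by_ y))[n hn].
  have := nbhs_agree n y; apply: filterS => y' yy'.
  exact: hn.
- move=> y z /(G0P sE hf)[l [yE zE zl yz]].
  have sl := size_El sE hf l.
  pose e := E (restr f l).
  rewrite (@spliceE e (branch_val y l) (branch_val y) (branch_val y)) ?sl //.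
  rewrite (@spliceE e (branch_val z l) (branch_val z) (branch_val y)) ?sl //.
  by apply/(cyc l y).
- move=> m z mz i j nij.
  have [l hl] := injective_cycle_block sE hf (proj1 mz) (minimal_cycle_inj mz).
  have sl := size_El sE hf l.
  have zE i' : branch_val (z i') =
      splice (E (restr f l)) (branch_val (z i') l) (branch_val (z ord0)).
    by have [h1 h2] := hl i'; apply: spliceE; rewrite ?sl.
  rewrite (zE i) (zE j) => /(cyc l (z ord0))-/(_ (by_ _ _) (by_ _ _)) e.
  apply: nij; apply/(G0P sE hf); exists l.
  have [i1 i2] := hl i; have [j1 j2] := hl j; split => // k lk.
  by rewrite i2 // j2.
Qed.

End Existence.

(** * Baire category on branches *)
Section Category.
Variable f : nat -> nat.

Lemma agreeW n m (y y' : branches f) : (n <= m)%N -> agree m y y' -> agree n y y'.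
Proof. by move=> nm a j jn; apply: a; apply: leq_trans nm. Qed.

Lemma agree_trans n (y y' y'' : branches f) :
  agree n y y' -> agree n y' y'' -> agree n y y''.
Proof. by move=> a b j jn; rewrite b // a. Qed.

Lemma nbhs_branches (y : branches f) (A : set (branches f)) :
  nbhs y A -> exists n, agree n y `<=` A.
Proof.
pose cyl : set_system (branches f) := [set A | exists n, agree n y `<=` A].
have cylF : Filter cyl.
  constructor.
  - by exists 0%N.
  - move=> P Q [n nP] [m mQ]; exists (maxn n m) => y' a; split.
      by apply: nP; apply: agreeW a; apply: leq_maxl.
    by apply: mQ; apply: agreeW a; apply: leq_maxr.
  - by move=> P Q PQ [n nP]; exists n => y' /nP/PQ.
suff : cyl --> y by apply.
apply/cvg_sup => i U.
rewrite (@nbhsE (initial_topology _)) => -[W [[C oC <-] Cy]] CU.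
exists i.+1 => y' a; apply: CU => /=.
rewrite (_ : y' i = y i) //.
by apply: val_inj; apply: a.
Qed.

Definition dense_open (O : set (branches f)) : Prop :=
  forall y n, exists2 y', agree n y y' & exists m, agree m y' `<=` O.

(** Every comeager set is of this form: enlarge the members of a sequence of
    dense open sets that witnesses it. *)
Definition residual (G : set (branches f)) : Prop :=
  exists2 O : nat -> set (branches f),
    forall n, dense_open (O n) & G = \bigcap_n O n.

Lemma dense_openT : dense_open setT.
Proof. by move=> y n; exists y => //; exists 0%N. Qed.

Lemma residualT : residual setT.
Proof.
exists (fun _ => setT) => [_|]; first exact: dense_openT.
by apply/seteqP; split.
Qed.

Lemma residual_bigcap (G : nat -> set (branches f)) :
  (forall i, residual (G i)) -> residual (\bigcap_i G i).
Proof.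
move=> rG.
have /choice[O hO] : forall i, exists O : nat -> set (branches f),
    (forall n, dense_open (O n)) /\ G i = \bigcap_n O n.
  by move=> i; have [O ? ?] := rG i; exists O.
exists (fun k => if unpickle k is Some (i, n) then O i n else setT).
  move=> k; case: (unpickle k : option (nat * nat)) => [[i n]|].
    by case: (hO i).
  exact: dense_openT.
apply/seteqP; split=> [y Gy k _|y Oy i _].
  case: (unpickle k : option (nat * nat)) => [[i n]|//].
  by have := Gy i I; rewrite (proj2 (hO i)); apply.
rewrite (proj2 (hO i)) => n _.
by have := Oy (pickle (i, n)) I; rewrite pickleK.
Qed.

Lemma residual1 (O : set (branches f)) : dense_open O -> residual O.
Proof.
move=> dO; exists (fun _ => O) => //.
by apply/seteqP; split => [y Oy n _|y /(_ 0%N I)].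
Qed.

Lemma residualI (G G' : set (branches f)) :
  residual G -> residual G' -> residual (G `&` G').
Proof.
move=> rG rG'.
rewrite -bigcap2E; apply: residual_bigcap => -[|[|n]] //=.
exact: residualT.
Qed.

Theorem baire (G : set (branches f)) y n :
  residual G -> exists2 y', agree n y y' & G y'.
Proof.
move=> [O dO ->].
have /choice[nx hnx] : forall s : nat * (branches f * nat),
    exists t : branches f * nat,
    [/\ agree s.2.2 s.2.1 t.1, (s.2.2 < t.2)%N & agree t.2 t.1 `<=` O s.1].
  move=> [k [y0 n0]]; have [y' a [m mO]] := dO k y0 n0.
  exists (y', maxn m n0.+1); split => //=; first by rewrite leq_max ltnSn orbT.
  by move=> y'' /(agreeW (leq_maxl _ _))/mO.
pose st := fix st k := if k is k'.+1 then nx (k', st k') else (y, n).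
have mono k d : ((st k).2 <= (st (k + d)%N).2)%N /\
    agree (st k).2 (st k).1 (st (k + d)%N).1.
  elim: d => [|d [IH1 IH2]]; first by rewrite addn0.
  rewrite addnS; have [/= h1 h2 _] := hnx ((k + d)%N, st (k + d)%N).
  split; first exact: leq_trans (ltnW h2).
  by apply: agree_trans IH2 _; apply: agreeW h1.
have big k : (k <= (st k).2)%N.
  by elim: k => // k IH; have [_ /(leq_ltn_trans IH)] := hnx (k, st k).
pose z : branches f := fun k => (st k.+1).1 k.
have az k : agree (st k).2 (st k).1 z.
  move=> j jk; rewrite /z /branch_val -/(branch_val (st j.+1).1 j).
  case: (leqP k j.+1) => kj.
    by have [_] := mono k (j.+1 - k)%N; rewrite subnKC //; apply.
  have [_] := mono j.+1 (k - j.+1)%N; rewrite subnKC ?(ltnW kj) // => a.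
  by rewrite -a.
exists z; first exact: (az 0%N).
move=> k _; have [_ _] := hnx (k, st k); apply.
exact: (az k.+1).
Qed.

(** A set has the Baire property when its indicator function is continuous on a
    comeager set. *)
Definition baire_property (A : set (branches f)) : Prop :=
  exists2 G, residual G & forall y, G y ->
    exists k, forall y', agree k y y' -> G y' -> (A y' <-> A y).

(** Points at which [A] is decided by finitely many coordinates, relative to [G],
    form a set with dense interior. *)
Lemma baire_property_rel_open (A G : set (branches f)) : residual G ->
  (forall y, G y -> A y -> exists k, forall y', agree k y y' -> G y' -> A y') ->
  baire_property A.
Proof.
move=> rG Aop.
pose W := [set y | exists k,
  (forall y', agree k y y' -> G y' -> A y') \/
  (forall y', agree k y y' -> G y' -> ~ A y')].
exists (G `&` W); last first.
  move=> y [Gy [k [h|h]]]; exists k => y' a [Gy' _]; split => //.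
  - by move=> _; apply: h.
  - by move=> _; apply: h.
  - by move=> /(h _ a Gy').
  - by move=> /(h y _ Gy); case.
apply: residualI rG _; apply: residual1 => y n.
have [[y' [a Gy' Ay']]|no] := pselect (exists y', [/\ agree n y y', G y' & A y']).
  have [k hk] := Aop y' Gy' Ay'.
  exists y' => //; exists k => y'' a'; exists k; left => y3 a3.
  by apply: hk; apply: agree_trans a3.
exists y => //; exists n => y'' a; exists n; right => y3 a3 Gy3 Ay3.
by apply: no; exists y3; split => //; apply: agree_trans a3.
Qed.

Lemma baire_propertyC A : baire_property A -> baire_property (~` A).
Proof.
move=> [G rG h]; exists G => // y Gy; have [k hk] := h y Gy.
by exists k => y' a Gy'; have := hk y' a Gy'; rewrite /setC /mkset => ->.
Qed.

Lemma baire_property_bigcup (A : nat -> set (branches f)) :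
  (forall i, baire_property (A i)) -> baire_property (\bigcup_i A i).
Proof.
move=> bA.
have /choice[G hG] : forall i, exists G, residual G /\ forall y, G y ->
    exists k, forall y', agree k y y' -> G y' -> (A i y' <-> A i y).
  by move=> i; have [G ? ?] := bA i; exists G.
apply: (@baire_property_rel_open _ (\bigcap_i G i)).
  by apply: residual_bigcap => i; case: (hG i).
move=> y Gy [i _ Ay]; case: (hG i) => _ /(_ y (Gy i I))[k hk].
exists k => y' a Gy'; exists i => //; apply/(hk y' a) => //; exact: Gy'.
Qed.

Lemma baire_property_borel (X : topologicalType) (Pi : branches f -> X)
    (S : set X) :
  continuous Pi -> borel S -> baire_property (Pi @^-1` S).
Proof.
move=> cPi.
have : <<s @open X >> `<=` [set S | baire_property (Pi @^-1` S)].
  apply: smallest_sub.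
    split.
    - apply: (baire_property_rel_open residualT) => y _ [].
    - by move=> A bA; rewrite /= setTD preimage_setC; apply: baire_propertyC.
    - by move=> A bA; rewrite /= preimage_bigcup; apply: baire_property_bigcup.
  move=> O oO /=; apply: (baire_property_rel_open residualT) => y _ Oy.
  have /nbhs_branches[k hk] : nbhs y (Pi @^-1` O).
    by apply: cPi; apply: open_nbhs_nbhs.
  by exists k => y' a _; apply: hk.
exact.
Qed.

Definition mk_branch (x : nat -> nat) (xf : forall k, (x k < f k)%N) : branches f :=
  fun k => Ordinal (xf k).

End Category.

Lemma injective_unbounded (g : nat -> nat) k :
  injective g -> exists r, (k <= g r)%N.
Proof.
move=> ginj; apply: contrapT => no.
have gk r : (g r < k)%N by rewrite ltnNge; apply/negP => h; apply: no; exists r.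
have : (size (map g (iota 0 k.+1)) <= size (iota 0 k))%N.
  apply: uniq_leq_size; first by rewrite (map_inj_uniq ginj) iota_uniq.
  by move=> _ /mapP[r _ ->]; rewrite mem_iota /= add0n.
by rewrite size_map !size_iota ltnn.
Qed.

(** At length [l] the selector copies the finite sequence with number [l], cut
    down to the tree and padded with zeros; the first component of the pair
    makes every sequence appear at arbitrarily large lengths. *)
Definition dense_selector (s : seq nat) : seq nat :=
  let u := if (unpickle (size s) : option (nat * seq nat)) is Some ru
           then ru.2 else [::] in
  mkseq (fun k => minn (nth 0%N u k) (nth 0%N s k).-1) (size s).

Lemma dense_selectorP : selector dense_selector.
Proof.
move=> s s2; rewrite /finite_product /mkset all2E size_mkseq eqxx /=.
apply/(all_nthP (0, 0)%N) => k; rewrite size_zip size_mkseq minnn => ks.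
rewrite nth_zip ?size_mkseq //= nth_mkseq // gtn_min; apply/orP; right.
have : (1 < nth 0 s k)%N by apply: (allP s2); apply: mem_nth.
by case: (nth 0%N s k).
Qed.

Lemma dense_selector_dense (f : nat -> nat) (y : branches f) k :
  exists2 l, (k <= l)%N & forall j, (j < k)%N ->
    nth 0%N (dense_selector (restr f l)) j = branch_val y j.
Proof.
pose g (r : nat) := pickle (r, restr (branch_val y) k).
have ginj : injective g by move=> r r' /(pcan_inj pickleK)[].
have [r kr] := injective_unbounded k ginj.
exists (g r) => // j jk; have jr := leq_trans jk kr.
rewrite /dense_selector size_mkseq pickleK nth_mkseq // !nth_mkseq //=.
apply/minn_idPl; have : (branch_val y j < f j)%N := ltn_ord _.
by case: (f j).
Qed.

(** Some piece pulls back to a set that is comeager around a branch [y].  A basic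
    cycle whose common vertex extends a long initial part of [y] can be moved
    into that comeager set by a generic choice [z] of its tail, because each of
    the maps [phi a], which put the tail after the vertex number [a] of the
    cycle, pulls comeager sets back to comeager sets. *)
Theorem no_borel_cover (X : topologicalType) (R : set (X * X)) (f : nat -> nat)
    (Pi : branches f -> X) (A : nat -> set X) :
  calF f -> continuous Pi ->
  (forall y z, G0 dense_selector f (y, z) -> R (Pi y, Pi z)) ->
  (forall i, borel (A i)) -> [set: X] = \bigcup_i A i ->
  exists i, contains_cycle R (A i).
Proof.
move=> hf cPi homPi bA covA.
have sE := dense_selectorP.
have /choice[G hG] : forall i, exists G, residual G /\ forall y, G y ->
    exists k, forall y', agree k y y' -> G y' -> (A i (Pi y') <-> A i (Pi y)).
  by move=> i; have [G ? ?] := baire_property_borel cPi (bA i); exists G.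
have rG : residual (\bigcap_i G i).
  by apply: residual_bigcap => i; case: (hG i).
have zero : forall k, (0 < f k)%N by move=> k; apply: leq_trans (hf k).
have [y _ Gy] := baire (mk_branch zero) 0 rG.
have [i _ Ay] : (\bigcup_i A i) (Pi y) by rewrite -covA.
have [k hk] := (proj2 (hG i)) y (Gy i I).
have [l kl lE] := dense_selector_dense y k.
have f_l0 : (0 < f l)%N := zero l.
pose e := dense_selector (restr f l).
have se : size e = l := size_El sE hf l.
have bv (z : branches f) j : (branch_val z j < f j)%N := ltn_ord _.
pose phi (a : 'I_(f l)) (z : branches f) : branches f :=
  mk_branch (splice_bounded sE hf (ltn_ord a) (bv z)).
have phiE a z : branch_val (phi a z) = splice e a (branch_val z) by [].
have phi_le a z z' j : (j <= l)%N ->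
    branch_val (phi a z) j = branch_val (phi a z') j.
  move=> jl; rewrite !phiE /splice se.
  by case: ltngtP jl.
have phi_gt a z j : (l < j)%N -> branch_val (phi a z) j = branch_val z j.
  by move=> lj; rewrite phiE splice_gt // se.
have rphi a (H : set (branches f)) : residual H -> residual (phi a @^-1` H).
  move=> [O dO ->].
  exists (fun n => phi a @^-1` O n); last by rewrite preimage_bigcap.
  move=> n z m; pose M := maxn m l.+1.
  have [z' az' [m' hm']] := dO n (phi a z) M.
  have mixb j : ((if (j <= l)%N then branch_val z j else branch_val z' j) < f j)%N.
    by case: ifP.
  exists (mk_branch mixb).
    move=> j jm; rewrite /branch_val /=; case: (leqP j l) => // lj.
    rewrite -/(branch_val z' j) az' ?phi_gt //.
    by apply: leq_trans jm _; apply: leq_maxl.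
  exists m' => z'' az''; apply: hm' => j jm'; case: (leqP j l) => jl.
    rewrite (phi_le a z'' z) // az' //.
    by apply: leq_trans (leq_maxr _ _); rewrite ltnS.
  by rewrite phi_gt // az'' // /branch_val /= leqNgt jl.
have [z _ Gz] : exists2 z, agree 0 y z &
    (\bigcap_j (if insub j is Some a then phi a @^-1` (\bigcap_i G i) else setT)) z.
  apply: baire; apply: residual_bigcap => j.
  by case: (insub j : option 'I_(f l)) => [a|]; [apply: rphi|apply: residualT].
have Gphi a : (\bigcap_i G i) (phi a z).
  by have := Gz a I; rewrite valK.
have Aphi a : A i (Pi (phi a z)).
  apply/(hk (phi a z)) => //; last exact: (Gphi a i I).
  move=> j jk; rewrite phiE /splice se (leq_trans jk kl).
  exact: lE.
exists i; apply/contains_cycleP; exists (f l) => //.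
exists (fun a => Pi (phi (insubd (Ordinal f_l0) a) z)) => // a al.
apply: homPi; apply/(G0P sE hf); exists l.
have a1 : (a.+1 %% f l < f l)%N by rewrite ltn_mod.
pose o j : 'I_(f l) := insubd (Ordinal f_l0) j.
have [p1 p2] := splice_El sE hf l (o a) (branch_val z).
have [q1 q2] := splice_El sE hf l (o (a.+1 %% f l)%N) (branch_val z).
split; rewrite ?phiE //; first by rewrite p2 q2 !val_insubd al a1.
by move=> j lj; rewrite !splice_gt // se.
Qed.

(** * The dichotomy *)
Lemma card_le_injective (I J : Type) :
  ([set: J] #<= [set: I])%card -> exists g : J -> I, injective g.
Proof.
move=> /card_leP[F].
pose el j := SigSub (mem_set (Logic.I : [set: J] j)).
exists (fun j => val (F (el j))) => j j' /val_inj.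
by move=> /(@inj _ _ _ F) -/(_ (mem_set Logic.I) (mem_set Logic.I)) [].
Qed.

Lemma acyclic_borel_cover_le (X : topologicalType) (R : set (X * X)) (I J : Type) :
  acyclic_borel_cover R J -> ([set: J] #<= [set: I])%card ->
  acyclic_borel_cover R I.
Proof.
move=> [A [bA cA nA]] /card_le_injective[g ginj].
pose A' i := [set x | exists2 j, g j = i & A j x].
have A'E i : A' i = set0 \/ exists j, A' i = A j.
  have [[j gj]|no] := pselect (exists j, g j = i).
    right; exists j; apply/seteqP; split => [x [j' gj']|x Ax]; last by exists j.
    by rewrite (ginj j' j) // gj'.
  by left; apply/seteqP; split => // x [j gj _]; apply: no; exists j.
exists A'; split.
- by move=> i; case: (A'E i) => [->|[j ->]//]; exact: borel0.
- apply/seteqP; split => // x _.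
  have [j _ Ax] : (\bigcup_i A i) x by rewrite -cA.
  by exists (g j) => //; exists j.
- move=> i; case: (A'E i) => [->|[j ->]//].
  by move=> [n [y [/(_ ord0)]]].
Qed.

(** Only the existence of a least cardinal needs an argument: it is the least
    finite size of a cover, if there is a finite cover, and that of [nat]
    otherwise. *)
Lemma weak_borel_dichromatic_number_le_nat (X : topologicalType) (R : set (X * X)) :
  weak_borel_dichromatic_number_le R nat <-> acyclic_borel_cover R nat.
Proof.
split=> [[I [cI _] Inat]|cnat]; first exact: acyclic_borel_cover_le cI Inat.
have [[n cn]|no] := pselect (exists n, acyclic_borel_cover R 'I_n); last first.
  exists nat => //; split => // J cJ; apply/infiniteP => /finite_setP[n Jn].
  apply: no; exists n; apply: acyclic_borel_cover_le cJ _.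
  by rewrite (card_le_eql Jn); have := @card_II n; rewrite card_eq_le => /andP[].
have ex : exists n, `[< acyclic_borel_cover R 'I_n >] by exists n; apply/asboolP.
case: (ex_minnP ex) => m /asboolP cm mmin.
have mII : ([set: 'I_m] #<= `I_m)%card.
  by have := @card_II m; rewrite card_eq_le => /andP[].
exists 'I_m; last by apply: card_le_trans mII (card_leT _).
split => // J cJ; apply: card_le_trans mII _.
have [/finite_setP[k Jk]|/infiniteP iJ] := pselect (finite_set [set: J]).
  rewrite (card_le_eqr Jk) card_le_II; apply: mmin; apply/asboolP.
  apply: acyclic_borel_cover_le cJ _; rewrite (card_le_eql Jk).
  by have := @card_II k; rewrite card_eq_le => /andP[].
exact: card_le_trans (card_leT _) iJ.
Qed.

Theorem theorem3p23 (K : realType) (X : topologicalType) (R : set (X * X))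
    (hR : borel_digraph K R) :
  exactly_one
    (weak_borel_dichromatic_number_le R nat)
    (forall E : seq nat -> seq nat, selector E ->
       exists2 f : nat -> nat, calF f &
         (forall n m : nat,
            prefix (E (restr f m)) (E (restr f n)) -> (f m <= f n)%N) /\
         (exists Pi : branches f -> X,
            continuous Pi /\ minimal_homomorphism (G0 E f) R Pi)).
Proof.
have [pX irr bR] := hR; have [hX [B sB]] := polish_sieve pX.
split; last first.
  move=> [/weak_borel_dichromatic_number_le_nat[A [bA cA nA]] alt].
  have [f hf [_ [Pi [cPi [hom _]]]]] := alt _ dense_selectorP.
  by have [i /(nA i)] := no_borel_cover hf cPi hom bA cA.
have [[A hA cA]|nX] := pselect (sigma_acyclic R setT).
  left; apply/weak_borel_dichromatic_number_le_nat; exists A; split => //.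
    by move=> i; case: (hA i).
  by move=> i; case: (hA i).
by right=> E sE; exact: (homomorphism_exists hX sB bR irr nX sE).
Qed.
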